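(* Let $\phi_1,\dots,\phi_n:\mathbb{R}^m\to\mathbb{R}$ be convex, differentiable with $(1/\gamma)$-Lipschitz gradients ($\gamma>0$), let $g:\mathbb{R}^d\to\mathbb{R}$ be $1$-strongly convex, $\lambda>0$, and let $A_1,\dots,A_n\in\mathbb{R}^{d\times m}$ be nonzero. Assume that at each iteration of the algorithm Quartz (described in the context) only one dual variable is updated, chosen at random according to $$\mathbb{P}(\hat S=\{i\})=p_i^*:=\frac{\lambda_{\max}(A_i^\top A_i)+\lambda\gamma n}{\sum_{k=1}^n\left(\lambda_{\max}(A_k^\top A_k)+\lambda\gamma n\right)},\qquad i\in[n],$$ and that $v_i=\lambda_{\max}(A_i^\top A_i)$ for all $i\in[n]$. If $0<\epsilon\le P(w^0)-D(\alpha^0)$ and the integer $T$ satisfies $$T\ge\left(n+\frac{\frac1n\sum_{i=1}^n\lambda_{\max}(A_i^\top A_i)}{\lambda\gamma}\right)\log\left(\frac{P(w^0)-D(\alpha^0)}{\epsilon}\right),$$ then $\mathbb{E}[P(w^T)-D(\alpha^T)]\le\epsilon$.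
   Context: $[n]=\{1,\dots,n\}$; $\|\cdot\|$ is the Euclidean norm. $g$ is $1$-strongly convex means $g(w)\ge g(w')+\langle s,w-w'\rangle+\tfrac12\|w-w'\|^2$ for all $w,w'$ and every subgradient $s$ of $g$ at $w'$. $\xi^*(u)=\sup_s\{\langle s,u\rangle-\xi(s)\}$ is the convex (Fenchel) conjugate (possibly $+\infty$ for $\phi_i^*$; $g^*$ is finite and $1$-smooth). The primal and dual objectives are $$P(w)=\frac1n\sum_{i=1}^n\phi_i(A_i^\top w)+\lambda g(w),\quad w\in\mathbb{R}^d,$$ $$D(\alpha)=-\lambda g^*\Big(\frac1{\lambda n}\sum_{i=1}^nA_i\alpha_i\Big)-\frac1n\sum_{i=1}^n\phi_i^*(-\alpha_i),\quad \alpha=(\alpha_1,\dots,\alpha_n)\in(\mathbb{R}^m)^n.$$ Algorithm Quartz (with random set $\hat S\subseteq[n]$, $p_i=\mathbb{P}(i\in\hat S)>0$, and positive vector $v\in\mathbb{R}^n$): choose $\alpha^0\in(\mathbb{R}^m)^n$, $w^0\in\mathbb{R}^d$ (deterministic); set $\theta=\min_i\frac{p_i\lambda\gamma n}{v_i+\lambda\gamma n}$ and $\bar\alpha^0=\frac1{\lambda n}\sum_iA_i\alpha_i^0$. For $t=1,2,\dots$: (1) $w^t=(1-\theta)w^{t-1}+\theta\nabla g^*(\bar\alpha^{t-1})$; (2) draw a random set $S_t\subseteq[n]$ with the distribution of $\hat S$, independently of all previous draws; (3) for $i\notin S_t$ put $\alpha_i^t=\alpha_i^{t-1}$; for $i\in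 S_t$ put $\alpha_i^t=\alpha_i^{t-1}+\Delta\alpha_i^t$, where $\Delta\alpha_i^t$ is given by one of the two options (the result holds for either option): Option I: $\Delta\alpha_i^t=\arg\max_{\Delta\in\mathbb{R}^m}\big[-\phi_i^*(-(\alpha_i^{t-1}+\Delta))-\nabla g^*(\bar\alpha^{t-1})^\top A_i\Delta-\frac{v_i\|\Delta\|^2}{2\lambda n}\big]$; Option II: $\Delta\alpha_i^t=-\theta p_i^{-1}\alpha_i^{t-1}-\theta p_i^{-1}\nabla\phi_i(A_i^\top w^t)$; (4) $\bar\alpha^t=\bar\alpha^{t-1}+\frac1{\lambda n}\sum_{i\in S_t}A_i\Delta\alpha_i^t$ (so $\bar\alpha^t=\frac1{\lambda n}\sum_iA_i\alpha_i^t$). *)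

(* Defs.v *)
From HB Require Import structures.
From mathcomp Require Export all_boot all_order all_algebra.
From mathcomp Require Export all_classical all_reals all_analysis.

Set Implicit Arguments.
Unset Strict Implicit.
Unset Printing Implicit Defensive.

Export Order.TTheory GRing.Theory Num.Theory.
Export numFieldNormedType.Exports.

Local Open Scope classical_set_scope.
Local Open Scope ring_scope.

(* The library norm `|x| on matrices is the sup norm; the Euclidean one is
   [enorm]. *)
Definition dot (R : realType) (k : nat) (x y : 'cV[R]_k) : R :=
  \sum_(i < k) x i 0 * y i 0.

Definition enorm (R : realType) (k : nat) (x : 'cV[R]_k) : R :=
  Num.sqrt (dot x x).

(* Meaningful where f is differentiable, as 'D_v is a total operator. *)
Definition grad (R : realType) (k : nat) (f : 'cV[R]_k -> R) (x : 'cV[R]_k) :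
    'cV[R]_k :=
  \col_(i < k) 'D_(delta_mx i 0) f x.

Definition lipschitz_gradient (R : realType) (k : nat) (L : R)
    (f : 'cV[R]_k -> R) : Prop :=
  forall x y, enorm (grad f x - grad f y) <= L * enorm (x - y).

Definition convex_on_space (R : realType) (k : nat) (f : 'cV[R]_k -> R) : Prop :=
  convex_function [set: convex_lmodType 'cV[R]_k] f.

Definition subgradient (R : realType) (k : nat) (f : 'cV[R]_k -> R)
    (x s : 'cV[R]_k) : Prop :=
  forall y, f x + dot s (y - x) <= f y.

(* Convexity is stated separately because the subgradient inequality is vacuous
   for a function without subgradients. *)
Definition strongly_convex1 (R : realType) (k : nat) (f : 'cV[R]_k -> R) : Prop :=
  convex_on_space f /\
  forall x y s, subgradient f x s ->
    f x + dot s (y - x) + 2^-1 * enorm (y - x) ^+ 2 <= f y.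

Definition conjugate (R : realType) (k : nat) (f : 'cV[R]_k -> R)
    (u : 'cV[R]_k) : \bar R :=
  ereal_sup (range (fun s => (dot s u - f s)%:E)).

(* To be used when the conjugate is finite everywhere. *)
Definition grad_conjugate (R : realType) (k : nat) (f : 'cV[R]_k -> R) :
    'cV[R]_k -> 'cV[R]_k :=
  grad (fun u => fine (conjugate f u)).

(* Largest eigenvalue of a square matrix of positive size with at least one
   real eigenvalue, in particular of A^T *m A. *)
Definition lambda_max (R : realType) (k : nat) (M : 'M[R]_k) : R :=
  sup [set a | eigenvalue M a].

Definition primal (R : realType) (n d m : nat) (phi : 'I_n -> 'cV[R]_m -> R)
    (g : 'cV[R]_d -> R) (lam : R) (A : 'I_n -> 'M[R]_(d, m)) (w : 'cV[R]_d) : R :=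
  n%:R^-1 * \sum_(i < n) phi i ((A i)^T *m w) + lam * g w.

Definition dual_average (R : realType) (n d m : nat) (lam : R)
    (A : 'I_n -> 'M[R]_(d, m)) (alpha : 'I_n -> 'cV[R]_m) : 'cV[R]_d :=
  (lam * n%:R)^-1 *: \sum_(i < n) A i *m alpha i.

(* Equal to -oo when some - alpha i lies outside the domain of the conjugate of
   phi i. *)
Definition dual (R : realType) (n d m : nat) (phi : 'I_n -> 'cV[R]_m -> R)
    (g : 'cV[R]_d -> R) (lam : R) (A : 'I_n -> 'M[R]_(d, m))
    (alpha : 'I_n -> 'cV[R]_m) : \bar R :=
  (- (lam%:E * conjugate g (dual_average lam A alpha))
   - n%:R^-1%:E * \sum_(i < n) conjugate (phi i) (- alpha i))%E.

Definition random_set (dO : measure_display) (Omega : measurableType dO)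
    (n : nat) (S : Omega -> {set 'I_n}) : Prop :=
  forall B : {set 'I_n}, measurable (S @^-1` [set B]).

Definition same_law (R : realType) (dO : measure_display)
    (Omega : measurableType dO) (Pr : probability Omega R) (n : nat)
    (S S' : Omega -> {set 'I_n}) : Prop :=
  forall B : {set 'I_n}, Pr (S @^-1` [set B]) = Pr (S' @^-1` [set B]).

Definition independent_sets (R : realType) (dO : measure_display)
    (Omega : measurableType dO) (Pr : probability Omega R) (n : nat)
    (S : nat -> Omega -> {set 'I_n}) : Prop :=
  forall (J : seq nat) (B : nat -> set {set 'I_n}), uniq J ->
    Pr (\bigcap_(t in [set` J]) (S t @^-1` B t)) =
    (\big[mule/1]_(t <- J) Pr (S t @^-1` B t))%E.

(* The draw of iteration t >= 1 is S t; S 0 is irrelevant. *)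
Definition quartz_draws (R : realType) (dO : measure_display)
    (Omega : measurableType dO) (Pr : probability Omega R) (n : nat)
    (Shat : Omega -> {set 'I_n}) (S : nat -> Omega -> {set 'I_n}) : Prop :=
  [/\ random_set Shat,
      forall t, random_set (S t.+1),
      forall t, same_law Pr (S t.+1) Shat
    & independent_sets Pr (fun t => S t.+1)].

Definition inclusion_probability (R : realType) (dO : measure_display)
    (Omega : measurableType dO) (Pr : probability Omega R) (n : nat)
    (Shat : Omega -> {set 'I_n}) (i : 'I_n) : R :=
  fine (Pr [set omega | i \in Shat omega]).

(* The infimum of a finite nonempty set (n > 0), i.e. its minimum. *)
Definition quartz_theta (R : realType) (n : nat) (lam gam : R) (p v : 'I_n -> R) : R :=
  inf (range (fun i : 'I_n =>
    p i * lam * gam * n%:R / (v i + lam * gam * n%:R))).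

Definition is_argmax (R : realType) (X : Type) (f : X -> \bar R) (x : X) : Prop :=
  forall y, (f y <= f x)%E.

Inductive quartz_option := OptionI | OptionII.

(* delta is an admissible update of the i-th dual block, where a is its current
   value, ab the current average of the dual variables, and w the new primal
   iterate. *)
Definition quartz_update (R : realType) (n d m : nat) (opt : quartz_option)
    (phi : 'I_n -> 'cV[R]_m -> R) (g : 'cV[R]_d -> R) (lam theta : R)
    (A : 'I_n -> 'M[R]_(d, m)) (p v : 'I_n -> R) (i : 'I_n)
    (w ab : 'cV[R]_d) (a delta : 'cV[R]_m) : Prop :=
  match opt with
  | OptionI =>
      is_argmax (fun D : 'cV[R]_m =>
        (- conjugate (phi i) (- (a + D))
         - (dot (grad_conjugate g ab) (A i *m D))%:E
         - (v i * enorm D ^+ 2 / (2 * lam * n%:R))%:E)%E) delta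
  | OptionII =>
      delta = - (theta * (p i)^-1) *: a
              - (theta * (p i)^-1) *: grad (phi i) ((A i)^T *m w)
  end.

(* One trajectory of the algorithm for a given realization S of the draws;
   p i is the probability that the random set contains i. *)
Record quartz_path (R : realType) (n d m : nat) (opt : quartz_option)
    (phi : 'I_n -> 'cV[R]_m -> R) (g : 'cV[R]_d -> R) (lam gam : R)
    (A : 'I_n -> 'M[R]_(d, m)) (p v : 'I_n -> R)
    (w0 : 'cV[R]_d) (alpha0 : 'I_n -> 'cV[R]_m) (S : nat -> {set 'I_n})
    (w : nat -> 'cV[R]_d) (alpha : nat -> 'I_n -> 'cV[R]_m)
    (abar : nat -> 'cV[R]_d) (Delta : nat -> 'I_n -> 'cV[R]_m) : Prop := {
  quartz_w0 : w 0%N = w0;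
  quartz_alpha0 : forall i, alpha 0%N i = alpha0 i;
  quartz_abar0 : abar 0%N = dual_average lam A alpha0;
  quartz_w : forall t, let theta := quartz_theta lam gam p v in
    w t.+1 = (1 - theta) *: w t + theta *: grad_conjugate g (abar t);
  quartz_Delta : forall t i, i \in S t.+1 ->
    quartz_update opt phi g lam (quartz_theta lam gam p v) A p v i
      (w t.+1) (abar t) (alpha t i) (Delta t.+1 i);
  quartz_alpha_in : forall t i, i \in S t.+1 ->
    alpha t.+1 i = alpha t i + Delta t.+1 i;
  quartz_alpha_notin : forall t i, i \notin S t.+1 -> alpha t.+1 i = alpha t i;
  quartz_abar : forall t,
    abar t.+1 = abar t
      + (lam * n%:R)^-1 *: \sum_(i in S t.+1) A i *m Delta t.+1 i
}.

(* Main.v *)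
(* Strong convexity makes [g - <u, .>] have a minimizer w, which is the gradient
   of the conjugate of g at u, and gives
     g^*(u + h) <= g^*(u) + <w, h> + |h|^2 / 2.
   Smoothness of phi_i makes its conjugate gam-strongly convex. For Option II,
   the step theta / p_i = lam gam n / (v_i + lam gam n) exactly balances the
   quadratic term v_i |Delta|^2 / (2 lam n) of the first bound against the
   strong convexity gain of the second, so that, by convexity of the primal
   objective, the duality gap contracts by 1 - theta in conditional
   expectation; Option I maximizes the lower bound on the dual used in this
   argument, hence does at least as well. Iterating,
   E[gap_T] <= (1 - theta)^T gap_0 <= exp (- theta T) gap_0, and 1 / theta is the
   factor n + (sum_i v_i) / (n lam gam) of the complexity bound. Since v_i > 0
   makes the Option I update unique, the T-th iterate is a function of the first
   T draws, which also gives its measurability. *)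
Require Import Defs.
From mathcomp Require Import measurable_realfun ring lra.

Set Implicit Arguments.
Unset Strict Implicit.
Unset Printing Implicit Defensive.

Local Open Scope classical_set_scope.
Local Open Scope ring_scope.

(** * Euclidean inner product and Rayleigh quotients *)

Section dot_product.
Context {R : realType}.

Lemma dotC k (x y : 'cV[R]_k) : dot x y = dot y x.
Proof. by apply: eq_bigr => i _; rewrite mulrC. Qed.

Lemma dotDl k (x y z : 'cV[R]_k) : dot (x + y) z = dot x z + dot y z.
Proof. by rewrite -big_split; apply: eq_bigr => i _; rewrite mxE mulrDl. Qed.

Lemma dotZl k a (x y : 'cV[R]_k) : dot (a *: x) y = a * dot x y.
Proof. by rewrite [RHS]mulr_sumr; apply: eq_bigr => i _; rewrite mxE mulrA. Qed.

Lemma dotNl k (x y : 'cV[R]_k) : dot (- x) y = - dot x y.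
Proof. by rewrite -scaleN1r dotZl mulN1r. Qed.

Lemma dotDr k (x y z : 'cV[R]_k) : dot z (x + y) = dot z x + dot z y.
Proof. by rewrite !(dotC z) dotDl. Qed.

Lemma dotZr k a (x y : 'cV[R]_k) : dot x (a *: y) = a * dot x y.
Proof. by rewrite dotC dotZl dotC. Qed.

Lemma dotNr k (x y : 'cV[R]_k) : dot x (- y) = - dot x y.
Proof. by rewrite dotC dotNl dotC. Qed.

Definition dotE := (@dotDl, @dotDr, @dotNl, @dotNr, @dotZl, @dotZr).

Lemma dot0r k (x : 'cV[R]_k) : dot x 0 = 0.
Proof. by rewrite -(scale0r 0) dotZr mul0r. Qed.

Lemma dot_sumr k (I : finType) (P : pred I) (x : 'cV[R]_k) (F : I -> 'cV[R]_k) :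
  dot x (\sum_(i | P i) F i) = \sum_(i | P i) dot x (F i).
Proof. by apply: (big_morph _ (fun a b => dotDr a b x) (dot0r x)). Qed.

Lemma dot_delta k (x : 'cV[R]_k) j : dot x (delta_mx j 0) = x j 0.
Proof.
rewrite /dot (bigD1 j)//= big1 ?addr0 => [|i ij]; rewrite mxE ?eqxx ?mulr1//.
by rewrite (negbTE ij) mulr0.
Qed.

Lemma dot_ge0 k (x : 'cV[R]_k) : 0 <= dot x x.
Proof. by apply: sumr_ge0 => i _; rewrite -expr2 sqr_ge0. Qed.

Lemma le_coord_dot k (x : 'cV[R]_k) i : x i 0 ^+ 2 <= dot x x.
Proof.
rewrite /dot (bigD1 i)//= -expr2 lerDl sumr_ge0// => j _.
by rewrite -expr2 sqr_ge0.
Qed.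

Lemma dot_eq0 k (x : 'cV[R]_k) : (dot x x == 0) = (x == 0).
Proof.
apply/eqP/eqP => [x0|->]; last by rewrite dot0r.
apply/matrixP => i j; rewrite ord1 mxE; apply/eqP.
by rewrite -sqrf_eq0 eq_le sqr_ge0 andbT -x0 le_coord_dot.
Qed.

Lemma dot_gt0 k (x : 'cV[R]_k) : (0 < dot x x) = (x != 0).
Proof. by rewrite lt_def dot_ge0 dot_eq0 andbT. Qed.

Lemma enorm_sqr k (x : 'cV[R]_k) : enorm x ^+ 2 = dot x x.
Proof. by rewrite sqr_sqrtr// dot_ge0. Qed.

Lemma dot_le_halfD k (x y : 'cV[R]_k) :
  dot x y <= 2^-1 * dot x x + 2^-1 * dot y y.
Proof.
by have := dot_ge0 (x - y); rewrite !dotE (dotC y x); lra.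
Qed.

Lemma dot_mulmx d m (A : 'M[R]_(d, m)) x y : dot (A *m x) y = dot x (A^T *m y).
Proof.
have dotM k (a b : 'cV[R]_k) : dot a b = (a^T *m b) 0 0.
  by rewrite mxE; apply: eq_bigr => i _; rewrite mxE.
by rewrite !dotM trmx_mul mulmxA.
Qed.

(** Positivity of [b] at [b y y *: x - b x y *: y] gives the claim when [b y y] is nonzero. The form
    may be degenerate, as it is in [eigenvalue_mu], where positivity is all that is known. *)
Lemma psd_cauchy_schwarz k (b : 'cV[R]_k -> 'cV[R]_k -> R) x y :
  (forall x y z, b (x + y) z = b x z + b y z) ->
  (forall a x y, b (a *: x) y = a * b x y) ->
  (forall x y, b x y = b y x) -> (forall x, 0 <= b x x) ->
  b x y ^+ 2 <= b x x * b y y.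
Proof.
move=> bD bZ bC b0.
have b2 s t : 0 <= s ^+ 2 * b x x + 2 * s * t * b x y + t ^+ 2 * b y y.
  have := b0 (s *: x + t *: y); congr (0 <= _).
  by rewrite bD !bZ !(bC _ (_ + _)) !bD !bZ (bC y x); ring.
have [y0|y0] := eqVneq (b y y) 0.
  have [->|xy] := eqVneq (b x y) 0; first by rewrite y0 expr0n/= mulr0.
  (* With [b y y = 0] the quadratic is affine in [t], and this [t] gives it the value [-1]. *)
  have := b2 1 (- ((b x x + 1) / (2 * b x y))).
  rewrite y0 (_ : 1 ^+ 2 * _ + _ + _ = -1) ?ler0N1//.
  by field.
have yy : 0 < b y y by rewrite lt_def y0 b0.
have := b2 (b y y) (- b x y).
have -> : b y y ^+ 2 * b x x + 2 * b y y * - b x y * b x y +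
   (- b x y) ^+ 2 * b y y = b y y * (b x x * b y y - b x y ^+ 2) by ring.
by rewrite pmulr_rge0// subr_ge0.
Qed.

Lemma cauchy_schwarz k (x y : 'cV[R]_k) : dot x y ^+ 2 <= dot x x * dot y y.
Proof.
by apply: (psd_cauchy_schwarz (b := @dot R k)) => *;
  rewrite ?dotDl ?dotZl ?dot_ge0// dotC.
Qed.

Lemma dot_le_enorm k (x y : 'cV[R]_k) : `|dot x y| <= enorm x * enorm y.
Proof.
rewrite -(ler_pXn2r (n := 2)) ?nnegrE ?mulr_ge0 ?sqrtr_ge0//.
by rewrite real_normK ?num_real// exprMn !enorm_sqr cauchy_schwarz.
Qed.

(** The constant is the squared Frobenius norm: Cauchy-Schwarz is applied to each row. *)
Lemma mulmx_bounded d m (A : 'M[R]_(d, m)) :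
  exists2 C, 0 <= C & forall x, dot (A *m x) (A *m x) <= C * dot x x.
Proof.
exists (\sum_i dot (row i A)^T (row i A)^T).
  by apply: sumr_ge0 => i _; exact: dot_ge0.
move=> x; rewrite mulr_suml; apply: ler_sum => i _.
rewrite -expr2 (_ : (A *m x) i 0 = dot (row i A)^T x) ?cauchy_schwarz//.
by rewrite mxE; apply: eq_bigr => j _; rewrite !mxE.
Qed.

End dot_product.

(** * Rayleigh quotients and the largest eigenvalue *)

Section rayleigh.
Context {R : realType} (d m : nat) (A : 'M[R]_(d, m)).
Let M := A^T *m A.

Let dotM x y : dot x (M *m y) = dot (A *m x) (A *m y).
Proof. by rewrite /M -mulmxA -dot_mulmx. Qed.

Let eigenvalue_has_ubound : has_ubound [set a | eigenvalue M a].
Proof.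
have [C _ AC] := mulmx_bounded A.
exists C => a /eigenvalueP[u uM u0].
have ut0 : 0 < dot u^T u^T.
  rewrite dot_gt0; apply: contra u0 => /eqP /(congr1 trmx).
  by rewrite trmxK trmx0 => ->.
have Mu : M *m u^T = a *: u^T.
  by rewrite -linearZ/= -uM trmx_mul /M trmx_mul trmxK.
by rewrite -(ler_pM2r ut0) -dotZr -Mu dotM.
Qed.

Let rayleigh := [set q | exists2 x, dot x x = 1 & q = dot (A *m x) (A *m x)].

Let rayleigh_has_ubound : has_ubound rayleigh.
Proof.
have [C _ AC] := mulmx_bounded A.
by exists C => _ [x x1 ->]; rewrite -(mulr1 C) -x1.
Qed.

Let mu := sup rayleigh.

Let rayleigh_le x : dot (A *m x) (A *m x) <= mu * dot x x.
Proof.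
have [->|x0] := eqVneq x 0; first by rewrite mulmx0 !dot0r mulr0.
have e0 : 0 < enorm x by rewrite sqrtr_gt0 dot_gt0.
have e2 := enorm_sqr x.
have x1 : dot ((enorm x)^-1 *: x) ((enorm x)^-1 *: x) = 1.
  by rewrite !dotE -e2; field; rewrite gt_eqF.
have /(ub_le_sup rayleigh_has_ubound) : rayleigh
    (dot (A *m ((enorm x)^-1 *: x)) (A *m ((enorm x)^-1 *: x))).
  by exists ((enorm x)^-1 *: x).
rewrite -/mu -scalemxAr !dotE mulrA -expr2 exprVn e2.
by rewrite ler_pdivrMl ?dot_gt0// mulrC.
Qed.

(* If [mu%:M - M] were invertible, Cauchy-Schwarz for this positive form would
   bound it below by a multiple of the identity, so [mu] would not be the least
   upper bound. *)
Let eigenvalue_mu : (0 < m)%N -> eigenvalue M mu.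
Proof.
move=> m0.
have x1 : dot (delta_mx (Ordinal m0) 0) (delta_mx (Ordinal m0) 0) = 1 :> R.
  by rewrite dot_delta mxE !eqxx.
have mu0 : 0 <= mu.
  by rewrite -(mulr1 mu) -x1 (le_trans _ (rayleigh_le _))// dot_ge0.
rewrite /eigenvalue /eigenspace kermx_eq0 row_free_unit.
apply/negP; set B := M - _ => Bunit.
have [C C0 BC] := mulmx_bounded (invmx B).
pose b (x y : 'cV[R]_m) : R := mu * dot x y - dot (A *m x) (A *m y).
have bE x y : b x y = - dot x (B *m y).
  by rewrite mulmxBl !dotE dotM mul_scalar_mx dotZr opprB.
have b0 x : 0 <= b x x by rewrite subr_ge0.
have bC x y : b x y = b y x by rewrite /b (dotC x) (dotC (A *m x)).
(* Cauchy-Schwarz for [b] at the pair [B *m x], [x], where [b] equals minus the squared norm of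
   [B *m x]; one factor of that squared norm is then cancelled. *)
have BB x : dot (B *m x) (B *m x) <= mu * b x x.
  have [->|Bx] := eqVneq (B *m x) 0; first by rewrite dot0r mulr_ge0.
  have := psd_cauchy_schwarz (b := b) (B *m x) x.
  rewrite bE sqrrN => /(_ _ _ bC b0) H.
  have {}H : dot (B *m x) (B *m x) ^+ 2 <= b (B *m x) (B *m x) * b x x.
    by apply: H => *; rewrite /b ?mulmxDr -?scalemxAr !dotE; ring.
  have BBmu : b (B *m x) (B *m x) <= mu * dot (B *m x) (B *m x).
    by rewrite lerBlDr lerDl dot_ge0.
  rewrite -(ler_pM2r (x := dot (B *m x) (B *m x))) ?dot_gt0// -expr2.
  by rewrite mulrAC (le_trans H)// ler_wpM2r.
(* The [+ 1] keeps the constant invertible when [C * mu] vanishes. *)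
have xb x : dot x x <= (C * mu + 1) * b x x.
  have := BC (B *m x); rewrite mulKmx// => /le_trans; apply.
  apply: (@le_trans _ _ (C * (mu * b x x))); first by rewrite ler_wpM2l.
  by rewrite mulrA ler_wpM2r// lerDl.
have K0 : 0 < C * mu + 1 by rewrite ltr_wpDl// mulr_ge0.
suff : mu <= mu - (C * mu + 1)^-1.
  by rewrite lerBrDr gerDl invr_le0 leNgt K0.
apply: ge_sup; first by eexists; exists (delta_mx (Ordinal m0) 0).
move=> _ [x xx ->]; have := xb x.
by rewrite /b xx mulr1 -ler_pdivrMl// mulr1 lerBrDr -lerBrDl.
Qed.

(** The supremum [mu] of the Rayleigh quotients is itself an eigenvalue, hence at most the supremum
    of the eigenvalues. For [m = 0] there is no eigenvalue, but the only vector is [0]. *)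
Lemma rayleigh_lambda_max (x : 'cV[R]_m) :
  dot (A *m x) (A *m x) <= lambda_max M * dot x x.
Proof.
have [m0|m0] := posnP m.
  have -> : x = 0 by apply/matrixP => i; have := ltn_ord i; rewrite {2}m0.
  by rewrite mulmx0 !dot0r mulr0.
apply: (le_trans (rayleigh_le x)); rewrite ler_wpM2r ?dot_ge0//.
by apply: ub_le_sup => //; exact: eigenvalue_mu.
Qed.

Lemma lambda_max_gt0 : A != 0 -> 0 < lambda_max M.
Proof.
move=> A0; have [j Aj] : exists j, A *m delta_mx j (0 : 'I_1) != 0.
  apply/existsP; apply: contraNT A0 => /existsPn A0.
  apply/eqP/matrixP => i j; have := A0 j; rewrite negbK -colE => /eqP.
  by move/matrixP => /(_ i 0); rewrite !mxE.
have := rayleigh_lambda_max (delta_mx j 0); rewrite dot_delta mxE !eqxx mulr1.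
by apply: lt_le_trans; rewrite dot_gt0.
Qed.

End rayleigh.

(** * Convexity, subgradients and conjugates *)

Section convexity.
Context {R : realType}.

Lemma convex_on_spaceP k (f : 'cV[R]_k -> R) : convex_on_space f ->
  forall t x y, 0 <= t -> t <= 1 ->
    f (t *: x + (1 - t) *: y) <= t * f x + (1 - t) * f y.
Proof.
move=> fconv t x y t0 t1.
by have := fconv (Itv01 t0 t1) x y (mem_setT _) (mem_setT _).
Qed.

(* One-dimensional Hahn-Banach extension step: the slopes of [H] to the left of
   the subspace lie below the slopes to its right. *)
Lemma convex_extension_slope k (H : 'cV[R]_k -> R) (V : 'cV[R]_k -> Prop) e :
  (forall t x y, 0 <= t -> t <= 1 ->
    H (t *: x + (1 - t) *: y) <= t * H x + (1 - t) * H y) ->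
  V 0 -> (forall a b x y, V x -> V y -> V (a *: x + b *: y)) ->
  (forall z, V z -> 0 <= H z) ->
  exists c, forall z t, V z -> c * t <= H (z + t *: e).
Proof.
move=> Hconv V0 VD HV.
pose L := [set q | exists z t, [/\ V z, 0 < t & q = - H (z - t *: e) / t]].
have LR z t z' t' : V z -> 0 < t -> V z' -> 0 < t' ->
    - H (z - t *: e) / t <= H (z' + t' *: e) / t'.
  move=> Vz t0 Vz' t0'; have tt : 0 < t + t' by rewrite addr_gt0.
  (* The weight for which the [e] components of the two points cancel. *)
  pose l := t' / (t + t').
  have l1 : 1 - l = t / (t + t') by rewrite /l; field; rewrite gt_eqF.
  have l0 : 0 <= l by rewrite divr_ge0// ltW.
  have ll1 : l <= 1 by rewrite ler_pdivrMr// mul1r lerDr ltW.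
  have := Hconv _ (z - t *: e) (z' + t' *: e) l0 ll1.
  have -> : l *: (z - t *: e) + (1 - l) *: (z' + t' *: e)
      = l *: z + (1 - l) *: z'.
    rewrite !scalerDr scalerN !scalerA addrACA -scaleNr -scalerDl.
    rewrite (_ : - (l * t) + (1 - l) * t' = 0) ?scale0r ?addr0//.
    by rewrite l1 /l; field; rewrite gt_eqF.
  move=> /(le_trans (HV _ (VD _ _ _ _ Vz Vz'))).
  rewrite l1 /l => H0.
  rewrite -subr_ge0.
  have -> : H (z' + t' *: e) / t' - - H (z - t *: e) / t =
     (t' / (t + t') * H (z - t *: e) + t / (t + t') * H (z' + t' *: e))
      * (t + t') / (t * t').
    by field; rewrite !gt_eqF.
  by rewrite divr_ge0 ?mulr_ge0// ltW.
have Lub z' t' : V z' -> 0 < t' -> ubound L (H (z' + t' *: e) / t').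
  by move=> Vz' t0' _ [z [t [Vz t0 ->]]]; exact: LR.
have L0 : L !=set0 by exists (- H (0 - 1 *: e) / 1); exists 0, 1.
exists (sup L) => z t Vz; have [t0|t0|->] := ltgtP t 0.
- have nt0 : 0 < - t by rewrite oppr_gt0.
  have : - H (z - (- t) *: e) / (- t) <= sup L.
    apply: ub_le_sup; last by exists z, (- t).
    by exists (H (0 + 1 *: e) / 1); exact: Lub.
  by rewrite ler_pdivrMr// scaleNr opprK; lra.
- by rewrite -ler_pdivlMr//; apply: ge_sup => //; exact: Lub.
- by rewrite mulr0 scale0r addr0 HV.
Qed.

(** Finite-dimensional Hahn-Banach: by induction on [j], an affine minorant is built on the vectors
    supported on the first [j] coordinates, and [convex_extension_slope] supplies the slope along
    the next one. *)
Lemma convex_subgradient k (f : 'cV[R]_k -> R) x :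
  convex_on_space f -> exists s, subgradient f x s.
Proof.
move=> /convex_on_spaceP fconv.
pose V j (y : 'cV[R]_k) := forall i : 'I_k, (j <= i)%N -> y i 0 = 0.
suff /(_ k (leqnn k))[s fs] : forall j, (j <= k)%N ->
    exists s, forall y, V j y -> f x + dot s y <= f (x + y).
  exists s => y; have := fs (y - x); rewrite subrKC; apply.
  by move=> i; rewrite leqNgt ltn_ord.
elim=> [_|j ih jk].
  exists 0 => y y0; rewrite (_ : y = 0) ?dot0r ?addr0//.
  by apply/matrixP => i l; rewrite ord1 mxE y0.
have [s fs] := ih (ltnW jk).
pose e : 'cV[R]_k := delta_mx (Ordinal jk) 0.
have [] := @convex_extension_slope _ (fun y => f (x + y) - f x - dot s y) (V j) e.
- move=> t y z t0 t1; rewrite !dotE.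
  have := fconv t (x + y) (x + z) t0 t1.
  rewrite !scalerDr addrACA -scalerDl subrKC scale1r; lra.
- by move=> i _; rewrite mxE.
- by move=> a b y z Vy Vz i ji; rewrite !mxE Vy// Vz// !mulr0 addr0.
- by move=> z /fs; lra.
move=> c cH; exists (s + c *: e) => y Vy.
pose t := y (Ordinal jk) 0.
have Vz : V j (y - t *: e).
  move=> i; rewrite leq_eqVlt => /predU1P[ji|ji].
    by rewrite !mxE (_ : i = Ordinal jk) ?eqxx ?mulr1 ?subrr//; exact: val_inj.
  rewrite !mxE Vy// (_ : (i == _) = false) ?mulr0 ?subrr//.
  by apply/eqP => /(congr1 val)/= ij; rewrite ij ltnn in ji.
have := cH _ t Vz; rewrite subrK dotDl dotZl (dotC e) dot_delta -/t; lra.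
Qed.

End convexity.

(** * Fenchel conjugates *)

Section conjugate.
Context {R : realType} (k : nat).
Implicit Types (f : 'cV[R]_k -> R) (u w s : 'cV[R]_k).

Lemma conjugate_ge f u s : ((dot s u - f s)%:E <= conjugate f u)%E.
Proof. by apply: ereal_sup_ubound; exists s. Qed.

Lemma conjugate_le f u M :
  (forall s, ((dot s u - f s)%:E <= M)%E) -> (conjugate f u <= M)%E.
Proof. by move=> fM; apply: ge_ereal_sup => _ [s _ <-]. Qed.

Lemma conjugate_neqNy f u : conjugate f u != -oo%E.
Proof. by rewrite -ltNye (lt_le_trans _ (conjugate_ge f u 0))// ltNyr. Qed.

Lemma conjugate_fin_num f u c :
  (conjugate f u <= c%:E)%E -> conjugate f u \is a fin_num.
Proof.
move=> fc; rewrite fin_numE conjugate_neqNy/= -ltey.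
by rewrite (le_lt_trans fc)// ltry.
Qed.

(** Equality case of Fenchel-Young: the subgradient inequality says that [w] attains the
    supremum. *)
Lemma conjugate_subgradient f w u :
  subgradient f w u -> conjugate f u = (dot w u - f w)%:E.
Proof.
move=> fwu; apply/eqP; rewrite eq_le conjugate_ge andbT.
apply: conjugate_le => s; rewrite lee_fin.
by have := fwu s; rewrite !dotE (dotC w) (dotC s); lra.
Qed.

End conjugate.

(** * Conjugates of strongly convex functions *)

Section strongly_convex.
Context {R : realType} (k : nat) (g : 'cV[R]_k -> R).
Hypothesis g_sc : strongly_convex1 g.

(** Average the two strong convexity bounds at the midpoint: the linear terms cancel, and half the
    squared norm of [(x - y) / 2] produces the factor [8^-1]. *)
Lemma strongly_convex_midpoint x y :
  g (2^-1 *: (x + y)) <= 2^-1 * (g x + g y) - 8^-1 * dot (x - y) (x - y).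
Proof.
have [gconv gsc] := g_sc.
have [s gs] := convex_subgradient (2^-1 *: (x + y)) gconv.
have := gsc _ x _ gs; have := gsc _ y _ gs; rewrite !enorm_sqr.
have -> : x - 2^-1 *: (x + y) = 2^-1 *: (x - y).
  by apply/matrixP => i j; rewrite !mxE; field.
have -> : y - 2^-1 *: (x + y) = - (2^-1 *: (x - y)).
  by apply/matrixP => i j; rewrite !mxE; field.
by rewrite !(dotNl, dotNr, dotZl, dotZr); lra.
Qed.

(* A minimizing sequence of [g - <u, .>] is Cauchy by strong convexity; its
   limit is built coordinatewise as a supremum, and the affine minorant of the
   function at the limit gives lower semicontinuity there. *)
Lemma strongly_convex_argmax u : exists w, subgradient g w u.
Proof.
have [gconv gsc] := g_sc.
pose F w := g w - dot u w.
have [s0 gs0] := convex_subgradient 0 gconv.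
have Flb : has_lbound (range F).
  exists (g 0 - 2^-1 * dot (s0 - u) (s0 - u)) => _ [w _ <-]; rewrite /F.
  have := gsc _ w _ gs0; rewrite enorm_sqr subr0.
  have := dot_le_halfD (u - s0) w; rewrite !dotE; lra.
have FI : has_inf (range F) by split=> //; exists (F 0), 0.
pose dl j : R := j.+1%:R^-1.
have dl0 j : 0 < dl j by rewrite invr_gt0.
have /choice[w Fw] : forall j, exists w, F w < inf (range F) + dl j ^+ 2.
  move=> j; have [|_ [w _ <-] Fw] := @inf_adherent _ _ (dl j ^+ 2) _ FI.
    by rewrite exprn_gt0.
  by exists w.
(* The midpoint of two near-minimizers cannot go below the infimum, so the squared distance is at
   most [4 * (dl j ^+ 2 + dl l ^+ 2)]; the errors were squared in the choice of [w] for this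
   purpose. *)
have wC j l i : `|w j i 0 - w l i 0| <= 2 * (dl j + dl l).
  have dj := dl0 j; have dk := dl0 l.
  rewrite -(ler_pXn2r (n := 2)) ?nnegrE//; last by lra.
  rewrite real_normK ?num_real//.
  have /le_trans -> // : (w j i 0 - w l i 0) ^+ 2 <= dot (w j - w l) (w j - w l).
    by have := le_coord_dot (w j - w l) i; rewrite !mxE.
  have := ge_inf Flb (ex_intro2 _ _ (2^-1 *: (w j + w l)) I erefl).
  rewrite /F => Fm; rewrite !(dotDr, dotZr) in Fm.
  have := strongly_convex_midpoint (w j) (w l).
  have := Fw j; have := Fw l; have := mulr_ge0 (ltW dj) (ltW dk); rewrite /F; lra.
(* By [wC] the intervals of radius [2 * dl j] around [w j i 0] meet pairwise, so the supremum of
   their left ends lies in all of them. *)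
pose z : 'cV[R]_k := \col_i sup (range (fun j => w j i 0 - 2 * dl j)).
have wub j i : ubound (range (fun j => w j i 0 - 2 * dl j)) (w j i 0 + 2 * dl j).
  by move=> _ [l _ <-]; have := wC l j i; rewrite ler_norml => /andP[_]/=; lra.
have wz j i : `|w j i 0 - z i 0| <= 2 * dl j.
  rewrite mxE ler_distlC.
  apply/andP; split.
    by apply: ub_le_sup; [exists (w 0%N i 0 + 2 * dl 0%N) | exists j].
  by apply: ge_sup; [exists (w 0%N i 0 - 2 * dl 0%N), 0%N | exact: wub].
have [s gs] := convex_subgradient z gconv.
exists z => y.
suff : F z <= F y by rewrite /F !dotE; lra.
apply: (@le_trans _ _ (inf (range F))); last by apply: ge_inf => //; exists y.
(* Chosen so that [C * dl j] bounds the inner product of [s - u] with [w j - z]. *)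
pose C := \sum_i `|(s - u) i 0| * 2.
have Fz j : F z <= inf (range F) + (1 + C) * dl j.
  have := gs (w j); have := Fw j; rewrite {1}/F => Fwj gwj.
  have : - (C * dl j) <= dot (s - u) (w j - z).
    rewrite lerNl -dotNr mulr_suml; apply: ler_sum => i _.
    rewrite (le_trans (ler_norm _))// normrM -mulrA ler_wpM2l//.
    rewrite (_ : (- (w j - z)) i 0 = - (w j i 0 - z i 0)) ?normrN ?wz//.
    by rewrite 3!mxE.
  have : dl j ^+ 2 <= dl j.
    by rewrite expr2 ler_piMr ?(ltW (dl0 j))// invf_le1 ?ltr0n ?ler1n.
  move: gwj; rewrite /F dotDl dotNl !(dotDr _ _ u) !(dotNr u); lra.
have C0 : 0 < 1 + C by rewrite ltr_pwDl// sumr_ge0// => i _; rewrite mulr_ge0.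
apply/ler_addgt0Pr => e e0.
have [j] := ltr_add_invr (divr_gt0 e0 C0).
rewrite add0r => je; apply: (le_trans (Fz j)); rewrite lerD2l.
by rewrite mulrC -ler_pdivlMr// ltW.
Qed.

(** For each competitor [s], the strong convexity gain at [w] absorbs the cross term
    [dot h (s - w)], up to half the squared norm of [h]. *)
Lemma conjugate_smooth w u h : subgradient g w u ->
  (conjugate g (u + h) <= (dot w u - g w + dot w h + 2^-1 * dot h h)%:E)%E.
Proof.
move=> gwu; apply: conjugate_le => s; rewrite lee_fin.
have := g_sc.2 _ s _ gwu; rewrite enorm_sqr.
have := dot_le_halfD h (s - w); rewrite !dotE.
rewrite (dotC u s) (dotC u w) (dotC h s) (dotC h w); lra.
Qed.

Lemma conjugate_sc_fin u : conjugate g u \is a fin_num.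
Proof.
have [w gwu] := strongly_convex_argmax u.
by rewrite (conjugate_subgradient gwu).
Qed.

(** The conjugate at [u + h] is squeezed between an affine function of slope [w] and the same
    function plus a quadratic in [h], so its directional derivatives at [u] are those of slope
    [w]. *)
Lemma grad_conjugate_subgradient w u : subgradient g w u -> grad_conjugate g u = w.
Proof.
move=> gwu; apply/matrixP => i j; rewrite ord1 mxE.
pose v : 'cV[R]_k := delta_mx i 0.
pose f u := fine (conjugate g u).
have fu : f u = dot w u - g w by rewrite /f (conjugate_subgradient gwu).
have fle h : f (u + h) <= f u + dot w h + 2^-1 * dot h h.
  rewrite fu -lee_fin; have := conjugate_smooth h gwu.
  by rewrite -{1}(fineK (conjugate_sc_fin _)).
have fge h : f u + dot w h <= f (u + h).
  rewrite fu -lee_fin /f (fineK (conjugate_sc_fin _)).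
  apply: le_trans (conjugate_ge _ _ w); rewrite lee_fin dotDr; lra.
rewrite -(dot_delta w) -/v -/f.
apply: cvg_lim => //; apply/cvgrPdist_le => e e0.
near=> h.
have h0 : h != 0 by near: h; exact: nbhs_dnbhs_neq.
have he : `|h| < e / (dot v v + 1).
  by near: h; apply: dnbhs0_lt; rewrite divr_gt0// ltr_wpDl// dot_ge0.
rewrite /= distrC (addrC _ u).
have -> : h^-1 *: (f (u + h *: v) - f u) - dot w v =
    h^-1 * (f (u + h *: v) - f u - dot w (h *: v)).
  by rewrite dotZr /GRing.scale/=; field.
rewrite normrM normfV ler_pdivrMl ?normr_gt0//.
have := fle (h *: v); have := fge (h *: v); rewrite !dotE => fg fl.
rewrite ger0_norm; last by lra.
have vv := dot_ge0 v.
have hv : `|h| * dot v v <= e.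
  have : `|h| * (dot v v + 1) < e by rewrite -ltr_pdivlMr// ltr_wpDl.
  by have := normr_ge0 h; lra.
have hh : h * h = `|h| * `|h| by rewrite -expr2 -real_normK ?num_real.
have := ler_wpM2l (normr_ge0 h) hv; rewrite mulrA -hh.
have : 0 <= h * h * dot v v by rewrite hh !mulr_ge0.
by lra.
Unshelve. all: by end_near.
Qed.

End strongly_convex.

(** * Smooth convex functions *)

Section smooth.
Context {R : realType} (k : nat).

Lemma derive_grad (f : 'cV[R]_k -> R) x v :
  differentiable f x -> 'D_v f x = dot (grad f x) v.
Proof.
move=> df; rewrite deriveE// dotC.
have {1}-> : v = \sum_i v i 0 *: delta_mx i 0.
  by rewrite {1}(matrix_sum_delta v); apply: eq_bigr => i _; rewrite big_ord1.
rewrite linear_sum; apply: eq_bigr => i _.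
by rewrite linearZ mxE deriveE.
Qed.

Lemma is_derive_line (f : 'cV[R]_k -> R) x v (t : R) :
  differentiable f (x + t *: v) ->
  is_derive t 1 (fun t => f (x + t *: v)) (dot (grad f (x + t *: v)) v).
Proof.
move=> df; rewrite -derive_grad//.
have E : (fun h : R => h^-1 *: (((fun t => f (x + t *: v)) \o shift t) (h *: 1)
             - f (x + t *: v))) =
    (fun h : R => h^-1 *: ((f \o shift (x + t *: v)) (h *: v) - f (x + t *: v))).
  apply/funext => h /=; congr (_ *: (f _ - _)).
  by rewrite (_ : h *: 1 = h) ?scalerDl 1?addrCA//; exact: mulr1.
have dv : derivable f (x + t *: v) v by exact: diff_derivable.
by apply: DeriveDef; [rewrite /derivable E | rewrite /derive E].
Qed.

(** Mean value theorem for [q], which is [h] minus a quadratic model: its derivative is nonpositive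
    on the unit interval. *)
Lemma derive_lipschitz_ub (h dh : R -> R) K :
  (forall t : R, is_derive t 1 h (dh t)) ->
  (forall t, 0 <= t -> t <= 1 -> dh t - dh 0 <= K * t) ->
  h 1 - h 0 - dh 0 <= 2^-1 * K.
Proof.
move=> hd hK.
pose q (t : R) : R := h t - dh 0 * t - 2^-1 * K * t ^+ 2.
have qd (t : R) : is_derive t 1 q (dh t - dh 0 - K * t).
  have hdt := hd t; apply: is_derive_eq.
  by rewrite /GRing.scale/=; field.
have qc : {within `[0, 1], continuous q}.
  apply: continuous_subspaceT => t.
  by apply: differentiable_continuous; apply/derivable1_diffP; apply: ex_derive.
have [c /andP[c0 c1] qE] := MVT ltr01 (fun t _ => qd t) qc.
have := hK c (ltW c0) (ltW c1); move: qE; rewrite /q; lra.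
Qed.

(** The one-dimensional bound along the segment from [x] to [y], once for [f] and once for [- f]. *)
Lemma lipschitz_gradient_quadratic (f : 'cV[R]_k -> R) L x y :
  (forall x, differentiable f x) -> lipschitz_gradient L f ->
  `|f y - f x - dot (grad f x) (y - x)| <= 2^-1 * L * dot (y - x) (y - x).
Proof.
move=> df fL; pose v := y - x.
pose dh t := dot (grad f (x + t *: v)) v.
have hd (t : R) : is_derive t 1 (fun t => f (x + t *: v)) (dh t).
  exact: is_derive_line.
have hd' (t : R) : is_derive t 1 (fun t => - f (x + t *: v)) (- dh t).
  exact: is_deriveN.
have dhL t : 0 <= t -> `|dh t - dh 0| <= L * dot v v * t.
  move=> t0; rewrite /dh scale0r addr0 -dotNl -dotDl.
  apply: (le_trans (dot_le_enorm _ _)).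
  apply: (@le_trans _ _ (L * enorm (t *: v) * enorm v)).
    rewrite ler_wpM2r ?sqrtr_ge0//; apply: le_trans (fL _ _) _.
    by rewrite (addrC x) addrK.
  have -> : enorm (t *: v) = t * enorm v.
    by rewrite /enorm dotZl dotZr mulrA -expr2 sqrtrM ?sqr_ge0// sqrtr_sqr ger0_norm.
  by rewrite -enorm_sqr le_eqVlt; apply/orP; left; apply/eqP; ring.
have dh0 : dh 0 = dot (grad f x) v by rewrite /dh scale0r addr0.
have Hu : f y - f x - dot (grad f x) v <= 2^-1 * (L * dot v v).
  have := derive_lipschitz_ub (K := L * dot v v) hd.
  rewrite scale1r scale0r addr0 /v subrKC -/v dh0; apply => t t0 _.
  by have := dhL t t0; rewrite dh0 ler_norml => /andP[_].
have Hl : - f y - - f x - - dot (grad f x) v <= 2^-1 * (L * dot v v).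
  have := derive_lipschitz_ub (K := L * dot v v) hd'.
  rewrite scale1r scale0r addr0 /v subrKC -/v dh0; apply => t t0 _.
  by have := dhL t t0; rewrite dh0 ler_norml => /andP[+ _]; lra.
by rewrite ler_norml; apply/andP; split; lra.
Qed.

Variables (f : 'cV[R]_k -> R) (gam : R).
Hypotheses (gam0 : 0 < gam) (f_convex : convex_on_space f).
Hypotheses (f_diff : forall x, differentiable f x).
Hypothesis f_smooth : lipschitz_gradient gam^-1 f.

Lemma grad_subgradient x : subgradient f x (grad f x).
Proof.
move=> y; rewrite -lerBrDl.
set c := dot _ _; set D := f y - f x.
(* Convexity on a segment of relative length [t] and the quadratic estimate give this inequality;
   then [t] tends to [0]. *)
suff H t : 0 < t -> t <= 1 -> c <= D + t * (2^-1 * gam^-1 * dot (y - x) (y - x)).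
  apply/ler_addgt0Pr => e e0; set B := dot _ _ in H.
  have B0 : 0 <= 2^-1 * gam^-1 * B by rewrite !mulr_ge0 ?invr_ge0 ?dot_ge0// ltW.
  have B1 : 0 < 2^-1 * gam^-1 * B + 1 by rewrite ltr_wpDl.
  pose t := Num.min 1 (e / (2^-1 * gam^-1 * B + 1)).
  have t0 : 0 < t by rewrite lt_min ltr01 divr_gt0.
  apply: (le_trans (H t t0 _)); first by rewrite ge_min lexx.
  rewrite lerD2l; apply: (@le_trans _ _ (t * (2^-1 * gam^-1 * B + 1))).
    by rewrite ler_pM2l// lerDl.
  by rewrite -ler_pdivlMr// ge_min lexx orbT.
move=> t0 t1.
have := lipschitz_gradient_quadratic x (x + t *: (y - x)) f_diff f_smooth.
have -> : x + t *: (y - x) - x = t *: (y - x) by rewrite addrAC subrr add0r.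
rewrite !dotE ler_norml => /andP[+ _].
have := convex_on_spaceP f_convex y x (ltW t0) t1.
have -> : t *: y + (1 - t) *: x = x + t *: (y - x).
  by apply/matrixP => i j; rewrite !mxE; ring.
set a := f (_ + _) => a1 a2; rewrite /c /D !dotE -(ler_pM2l t0); lra.
Qed.

Lemma conjugate_grad x : conjugate f (grad f x) = (dot (grad f x) x - f x)%:E.
Proof. by rewrite (conjugate_subgradient (grad_subgradient x)) dotC. Qed.

(* Smoothness of [f] bounds its conjugate below by the conjugate of a quadratic. *)
Lemma conjugate_ge_quadratic a z :
  ((dot a z - f z + 2^-1 * gam * dot (a - grad f z) (a - grad f z))%:E
    <= conjugate f a)%E.
Proof.
set q := grad f z.
(* This point maximizes [dot s a] minus the quadratic upper model of [f] around [z]. *)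
apply: le_trans (conjugate_ge _ _ (z + gam *: (a - q))); rewrite lee_fin.
have := lipschitz_gradient_quadratic z (z + gam *: (a - q)) f_diff f_smooth.
rewrite (_ : z + _ - z = gam *: (a - q)); last by rewrite addrAC subrr add0r.
rewrite ler_norml => /andP[_]; rewrite -/q.
set v := a - q.
have -> : 2^-1 * gam^-1 * dot (gam *: v) (gam *: v) = 2^-1 * gam * dot v v.
  by rewrite !dotE; field; rewrite gt_eqF.
rewrite dotDl !dotZr dotZl (dotC z).
have -> : dot v a = dot v v + dot q v by rewrite /v !dotE (dotC a q); ring.
by lra.
Qed.

(** For each [z], average the quadratic lower bounds at [a] and [u]. The averaged squared distances
    to [q] split into a variance term, which is the gain, and a nonnegative square, which is
    dropped. *)
Lemma conjugate_strongly_convex a u s c e : 0 <= s -> s <= 1 ->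
  conjugate f a = c%:E -> conjugate f u = e%:E ->
  (conjugate f ((1 - s) *: a + s *: u) <=
    ((1 - s) * c + s * e - 2^-1 * gam * s * (1 - s) * dot (a - u) (a - u))%:E)%E.
Proof.
move=> s0 s1 fa fu; apply: conjugate_le => z; rewrite lee_fin.
have := conjugate_ge_quadratic a z; have := conjugate_ge_quadratic u z.
rewrite fa fu !lee_fin; set q := grad f z => Hu Ha.
have Q := mulr_ge0 (ltW gam0) (dot_ge0 ((1 - s) *: a + s *: u - q)).
have s1' : 0 <= 1 - s by rewrite subr_ge0.
have := lerD (ler_wpM2l s1' Ha) (ler_wpM2l s0 Hu); move: Q.
have -> : dot ((1 - s) *: a + s *: u - q) ((1 - s) *: a + s *: u - q) =
   (1 - s) * dot (a - q) (a - q) + s * dot (u - q) (u - q)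
   - s * (1 - s) * dot (a - u) (a - u).
  by rewrite !dotE (dotC q a) (dotC q u) (dotC u a); ring.
have -> : dot z ((1 - s) *: a + s *: u) = (1 - s) * dot a z + s * dot u z.
  by rewrite !dotE !(dotC z).
lra.
Qed.

End smooth.

Lemma conjugate_midpoint (R : realType) k (f : 'cV[R]_k -> R) a b c e :
  conjugate f a = c%:E -> conjugate f b = e%:E ->
  (conjugate f (2^-1 *: (a + b)) <= (2^-1 * (c + e))%:E)%E.
Proof.
move=> fa fb; apply: conjugate_le => z; rewrite lee_fin.
have := conjugate_ge f a z; have := conjugate_ge f b z.
by rewrite fa fb !lee_fin !dotE; lra.
Qed.

(** * Duality gap and one iteration of Quartz *)

Section duality_gap.
Context {R : realType} (n d m : nat) (phi : 'I_n -> 'cV[R]_m -> R).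
Context (g : 'cV[R]_d -> R) (lam : R) (A : 'I_n -> 'M[R]_(d, m)).
Hypotheses (n_gt0 : (0 < n)%N) (lam_gt0 : 0 < lam) (g_sc : strongly_convex1 g).
Implicit Types (alpha : 'I_n -> 'cV[R]_m) (w : 'cV[R]_d).

Definition dual_finite alpha :=
  forall i, conjugate (phi i) (- alpha i) \is a fin_num.

(* Agrees with the primal minus the dual objective on [dual_finite] points. *)
Definition duality_gap w alpha : R := primal phi g lam A w
  + lam * fine (conjugate g (dual_average lam A alpha))
  + n%:R^-1 * \sum_i fine (conjugate (phi i) (- alpha i)).

Lemma duality_gapE w alpha : dual_finite alpha ->
  ((primal phi g lam A w)%:E - dual phi g lam A alpha)%E
  = (duality_gap w alpha)%:E.
Proof.
move=> fin; rewrite /dual /duality_gap -(fineK (conjugate_sc_fin g_sc _)).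
rewrite (eq_bigr (fun i => (fine (conjugate (phi i) (- alpha i)))%:E)).
  rewrite sumEFin -!EFinM -!(EFinN, EFinD); congr (_%:E); ring.
by move=> i _; rewrite fineK.
Qed.

(** Conjugates never take the value [-oo], so a single infinite term makes the dual [-oo], and no
    indeterminate form arises. *)
Lemma duality_gap_pinfty w alpha : ~ dual_finite alpha ->
  ((primal phi g lam A w)%:E - dual phi g lam A alpha)%E = +oo%E.
Proof.
move=> /existsNP[i /negP nfin]; rewrite /dual.
rewrite -(fineK (conjugate_sc_fin g_sc _)).
have -> : (\sum_(j < n) conjugate (phi j) (- alpha j) = +oo)%E.
  apply/esum_eqyP; first by move=> j _; exact: conjugate_neqNy.
  exists i; split; rewrite ?mem_index_enum//.
  by move: nfin; rewrite fin_numE conjugate_neqNy/= negbK => /eqP.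
by rewrite gt0_muley ?lte_fin ?invr_gt0 ?ltr0n// -EFinM -EFinN.
Qed.

Lemma dot_dual_average w alpha :
  lam * dot w (dual_average lam A alpha) =
  n%:R^-1 * \sum_i dot w (A i *m alpha i).
Proof.
rewrite dotZr dot_sumr mulrA; congr (_ * _); field.
by rewrite pnatr_eq0 -lt0n n_gt0 gt_eqF.
Qed.

(** Weak duality: Fenchel-Young for [g] and for each [phi i], whose inner products cancel by
    [dot_dual_average]. *)
Lemma duality_gap_ge0 w alpha : dual_finite alpha -> 0 <= duality_gap w alpha.
Proof.
move=> fin.
have gw : dot w (dual_average lam A alpha)
    <= g w + fine (conjugate g (dual_average lam A alpha)).
  rewrite -lerBlDl -lee_fin fineK ?conjugate_sc_fin//; exact: conjugate_ge.
have phiw i : - dot w (A i *m alpha i) <=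
    phi i ((A i)^T *m w) + fine (conjugate (phi i) (- alpha i)).
  rewrite -lerBlDl -lee_fin fineK ?fin//; apply: le_trans (conjugate_ge _ _ ((A i)^T *m w)).
  by rewrite lee_fin dotNr dot_mulmx trmxK.
have n0 : 0 <= n%:R^-1 :> R by rewrite invr_ge0 ler0n.
have := ler_wpM2l (ltW lam_gt0) gw; rewrite dot_dual_average.
have := ler_wpM2l n0 (ler_sum (index_enum _) (fun i (_ : true) => phiw i)).
rewrite sumrN big_split/= /duality_gap /primal; lra.
Qed.

End duality_gap.

(** * Contraction of the duality gap in one iteration *)

Section one_step.
Context {R : realType} (n d m : nat) (opt : quartz_option).
Context (phi : 'I_n -> 'cV[R]_m -> R) (g : 'cV[R]_d -> R) (lam gam theta : R).
Context (A : 'I_n -> 'M[R]_(d, m)) (p v : 'I_n -> R).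
Hypotheses (n_gt0 : (0 < n)%N) (lam_gt0 : 0 < lam) (gam_gt0 : 0 < gam).
Hypotheses (phi_convex : forall i, convex_on_space (phi i))
  (phi_diff : forall i x, differentiable (phi i) x)
  (phi_smooth : forall i, lipschitz_gradient gam^-1 (phi i))
  (g_sc : strongly_convex1 g).
Hypothesis v_gt0 : forall i, 0 < v i.
Hypothesis A_v : forall i x, dot (A i *m x) (A i *m x) <= v i * dot x x.
Hypotheses (p_gt0 : forall i, 0 < p i) (p_sum : \sum_i p i = 1).
(** Every index attains the minimum defining [theta], as happens for the probabilities of the
    theorem. *)
Hypothesis theta_p :
  forall i, theta * (v i + lam * gam * n%:R) = p i * (lam * gam * n%:R).

Let nR : 0 < n%:R :> R. Proof. by rewrite ltr0n. Qed.

Let lgn : 0 < lam * gam * n%:R. Proof. by rewrite !mulr_gt0. Qed.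

Let step i := theta / p i.

Let stepE i : step i = lam * gam * n%:R / (v i + lam * gam * n%:R).
Proof.
have vl : 0 < v i + lam * gam * n%:R by rewrite addr_gt0.
by apply/eqP; rewrite /step eqr_div ?lt0r_neq0// theta_p mulrC.
Qed.

Let step_ge0 i : 0 <= step i.
Proof. by rewrite stepE divr_ge0 ?addr_ge0// ltW. Qed.

Let step_le1 i : step i <= 1.
Proof. by rewrite stepE ler_pdivrMr ?mul1r ?addr_gt0// lerDr ltW. Qed.

Lemma theta_gt0 : 0 < theta.
Proof.
pose i := Ordinal n_gt0.
have vl : 0 < v i + lam * gam * n%:R by rewrite addr_gt0.
by rewrite -(pmulr_lgt0 _ vl) theta_p mulr_gt0.
Qed.

Lemma theta_le1 : theta <= 1.
Proof.
pose i := Ordinal n_gt0.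
have p1 : p i <= 1.
  by rewrite -p_sum (bigD1 i)//= lerDl sumr_ge0// => j _; exact: ltW.
apply: le_trans p1; rewrite -(mul1r (p i)) -ler_pdivrMr//; exact: step_le1.
Qed.

Section block.
Variables (i : 'I_n) (w ab : 'cV[R]_d) (a delta : 'cV[R]_m).
Hypothesis a_fin : conjugate (phi i) (- a) \is a fin_num.
Hypothesis upd : quartz_update opt phi g lam theta A p v i w ab a delta.
Let x := grad_conjugate g ab.
Let u := grad (phi i) ((A i)^T *m w).
Let ca := fine (conjugate (phi i) (- a)).
Let cu := dot u ((A i)^T *m w) - phi i ((A i)^T *m w).
(** Minus the Option I objective when [c] is the conjugate at [- (a + D)]. *)
Let surrogate D c := dot x (A i *m D) + v i / (2 * lam * n%:R) * dot D D + c.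

Let delta2 := - step i *: (a + u).

(** The Option II step moves [- a] towards [u] with weight [step i]. The strong convexity gain along
    this segment equals the quadratic penalty, by the identity [vs], so only first-order terms
    remain. *)
Let conjugate_delta2 : exists2 c, conjugate (phi i) (- (a + delta2)) = c%:E
  & surrogate delta2 c - ca <= - step i * (dot x (A i *m (a + u)) + ca - cu).
Proof.
have E : - (a + delta2) = (1 - step i) *: (- a) + step i *: u.
  by apply/matrixP => j l; rewrite !mxE; ring.
have := conjugate_strongly_convex gam_gt0 (phi_diff i) (@phi_smooth i)
  (step_ge0 i) (step_le1 i) (esym (fineK a_fin))
  (conjugate_grad gam_gt0 (@phi_convex i) (phi_diff i) (@phi_smooth i)
    ((A i)^T *m w)).
rewrite -/u -/cu -/ca -E => H; exists (fine (conjugate (phi i) (- (a + delta2)))).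
  by rewrite fineK// (conjugate_fin_num H).
have := H; rewrite -{1}(fineK (conjugate_fin_num H)) lee_fin /surrogate.
set c := fine _ => cle.
have -> : dot delta2 delta2 = step i ^+ 2 * dot (a + u) (a + u).
  by rewrite /delta2 dotZl dotZr; ring.
have -> : dot x (A i *m delta2) = - step i * dot x (A i *m (a + u)).
  by rewrite /delta2 -scalemxAr dotZr.
have E2 : dot (- a - u) (- a - u) = dot (a + u) (a + u).
  by rewrite -opprD dotNl dotNr opprK.
have vs : v i / (2 * lam * n%:R) * step i ^+ 2 = 2^-1 * gam * step i * (1 - step i).
  have vl : v i + lam * gam * n%:R != 0 by rewrite gt_eqF ?addr_gt0.
  by rewrite stepE; field; rewrite vl !gt_eqF.
by move: cle; rewrite E2 mulrA vs; lra.
Qed.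

(** Option II is exactly [delta2], and Option I minimizes the surrogate, hence does no worse.
    Multiplication by [p i] turns [step i] into [theta]. *)
Lemma quartz_update_decrease : exists2 c,
  conjugate (phi i) (- (a + delta)) = c%:E &
  p i * (dot x (A i *m delta) + v i / (2 * lam * n%:R) * dot delta delta + c - ca)
  <= - theta * (dot x (A i *m (a + u)) + ca - cu).
Proof.
have [c2 c2E H2] := conjugate_delta2.
suff [c cE H] : exists2 c, conjugate (phi i) (- (a + delta)) = c%:E &
    surrogate delta c <= surrogate delta2 c2.
  exists c => //; rewrite -/(surrogate delta c).
  have -> : theta = p i * step i by rewrite /step mulrC divfK// gt_eqF.
  by rewrite -mulrN -mulrA ler_pM2l//; apply: le_trans H2; rewrite lerD2r.
case: opt upd => /= [amax|deltaE]; last first.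
  suff -> : delta = delta2 by exists c2.
  by rewrite deltaE /delta2 -/u /step; apply/matrixP => j l; rewrite !mxE; ring.
have := amax delta2; rewrite c2E !enorm_sqr -/x -!EFinN -!EFinD.
(* The objective is finite at [delta2], so its maximizer cannot have an infinite conjugate. *)
have := conjugate_neqNy (phi i) (- (a + delta)).
case: (conjugate _ _) => // c _.
rewrite -!EFinN -!EFinD lee_fin => H; exists c => //.
by rewrite /surrogate; lra.
Qed.

End block.

Variables (w : 'cV[R]_d) (alpha : 'I_n -> 'cV[R]_m).
Let ab := dual_average lam A alpha.
Let x := grad_conjugate g ab.
Let w' := (1 - theta) *: w + theta *: x.
(** [beta i] stands for the dual point reached when the draw is the singleton of [i]. *)
Variables (Delta : 'I_n -> 'cV[R]_m) (beta : 'I_n -> 'I_n -> 'cV[R]_m).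
Hypothesis alpha_fin : dual_finite phi alpha.
Hypothesis upd :
  forall i, quartz_update opt phi g lam theta A p v i w' ab (alpha i) (Delta i).
Hypothesis beta_in : forall i, beta i i = alpha i + Delta i.
Hypothesis beta_notin : forall i j, j != i -> beta i j = alpha j.

Lemma quartz_step_finite i : dual_finite phi (beta i).
Proof.
move=> j; have [->|ji] := eqVneq j i; last by rewrite beta_notin.
rewrite beta_in; have [c -> _] := quartz_update_decrease (alpha_fin i) (upd i).
by [].
Qed.

Let x_subgradient : subgradient g x ab.
Proof.
have [y gy] := strongly_convex_argmax g_sc ab.
by rewrite /x (grad_conjugate_subgradient g_sc gy).
Qed.

Let u i := grad (phi i) ((A i)^T *m w').
Let cu i := dot (u i) ((A i)^T *m w') - phi i ((A i)^T *m w').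
Let ca i := fine (conjugate (phi i) (- alpha i)).

(** Only block [i] and the dual average change. Smoothness of the conjugate of [g] at [ab], with
    [A_v] for its quadratic term, bounds the change by [n%:R^-1] times the quantity controlled in
    [quartz_update_decrease]. *)
Let duality_gap_beta i : p i * duality_gap phi g lam A w' (beta i) <=
  p i * duality_gap phi g lam A w' alpha
  + n%:R^-1 * (- theta * (dot x (A i *m (alpha i + u i)) + ca i - cu i)).
Proof.
have [c cE H] := quartz_update_decrease (alpha_fin i) (upd i).
rewrite -lerBlDl -mulrBr.
apply: le_trans (ler_wpM2l _ H); last by rewrite invr_ge0 ltW.
rewrite mulrCA ler_pM2l// -/x -/(ca i) /duality_gap.
rewrite (bigD1 i)//= [in X in _ - X](bigD1 i)//= beta_in cE/= -/(ca i).
rewrite (eq_bigr ca) => [|j ji]; last by rewrite beta_notin.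
set rest := \sum_(j | _) _; set D := Delta i.
have abE : dual_average lam A (beta i) = ab + (lam * n%:R)^-1 *: (A i *m D).
  rewrite /ab /dual_average -scalerDr; congr (_ *: _).
  rewrite (bigD1 i)//= [in RHS](bigD1 i)//= beta_in mulmxDr addrAC.
  congr (_ + _ + _); apply: eq_bigr => j ji; by rewrite beta_notin.
have := conjugate_smooth g_sc ((lam * n%:R)^-1 *: (A i *m D)) x_subgradient.
rewrite abE -[X in (X <= _)%E](fineK (conjugate_sc_fin g_sc _)) lee_fin.
rewrite (_ : dual_average lam A alpha = ab)// (conjugate_subgradient x_subgradient).
set K := dot x ab - g x; set e := fine _ => /(ler_wpM2l (ltW lam_gt0)).
rewrite dotZl !dotZr => He.
have q0 : 0 <= (2 * lam * n%:R)^-1 by rewrite invr_ge0 !mulr_ge0// ltW.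
have N0 : 0 <= n%:R^-1 :> R by rewrite invr_ge0 ltW.
have /(ler_wpM2l q0)/(ler_wpM2l N0) := A_v i D.
move: He; set X := dot x (A i *m D); set Y := dot (A i *m D) _.
have -> : lam * (K + (lam * n%:R)^-1 * X
      + 2^-1 * ((lam * n%:R)^-1 * ((lam * n%:R)^-1 * Y))) =
    lam * K + n%:R^-1 * X + n%:R^-1 * ((2 * lam * n%:R)^-1 * Y).
  by field; rewrite !gt_eqF.
rewrite /=; lra.
Qed.

Lemma quartz_step_contraction :
  \sum_i p i * duality_gap phi g lam A w' (beta i) <=
  (1 - theta) * duality_gap phi g lam A w alpha.
Proof.
apply: (le_trans (ler_sum (index_enum _) (fun i (_ : true) => duality_gap_beta i))).
rewrite big_split/= -mulr_suml p_sum mul1r -!mulr_sumr.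
have th0 := theta_gt0; have th1 := theta_le1.
have n0 : 0 <= n%:R^-1 :> R by rewrite invr_ge0 ltW.
have gw : lam * g w' <= lam * ((1 - theta) * g w + theta * g x).
  rewrite ler_pM2l// /w'; have := convex_on_spaceP g_sc.1 (t := 1 - theta) w x.
  by rewrite subKr; apply; lra.
(* Gradient inequality at the image of [w'], tested at that of [w] and scaled by [1 - theta]; the
   definition of [w'] trades the inner product with [w] for the one with [x]. *)
have phiw i : phi i ((A i)^T *m w') - theta * (dot x (A i *m u i) - cu i)
    <= (1 - theta) * phi i ((A i)^T *m w).
  have := grad_subgradient gam_gt0 (@phi_convex i) (phi_diff i) (@phi_smooth i)
    ((A i)^T *m w') ((A i)^T *m w).
  rewrite -/(u i) /cu => H.
  have th : 0 <= 1 - theta by lra.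
  have := ler_wpM2l th H.
  have -> : dot x (A i *m u i) = dot (u i) ((A i)^T *m x).
    by rewrite dotC dot_mulmx.
  rewrite dotDr dotNr.
  have -> : dot (u i) ((A i)^T *m w') = (1 - theta) * dot (u i) ((A i)^T *m w)
      + theta * dot (u i) ((A i)^T *m x).
    by rewrite /w' mulmxDr -!scalemxAr dotDr !dotZr.
  lra.
have -> : \sum_i (dot x (A i *m (alpha i + u i)) + ca i - cu i) =
    \sum_i dot x (A i *m alpha i) + \sum_i dot x (A i *m u i)
    + \sum_i ca i - \sum_i cu i.
  by rewrite -sumrN -!big_split/=; apply: eq_bigr => i _; rewrite mulmxDr dotDr.
have := ler_wpM2l n0 (ler_sum (index_enum _) (fun i (_ : true) => phiw i)).
(* Since [x] attains the conjugate of [g] at [ab], this identity cancels what remains of the linear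
   terms. *)
have := dot_dual_average A n_gt0 lam_gt0 x alpha; move: gw.
rewrite /duality_gap /primal (conjugate_subgradient x_subgradient)/=.
rewrite -/ab -[\sum_(i < n) fine _]/(\sum_i ca i).
set S1 := \sum_i dot x (A i *m alpha i).
set S2 := \sum_i dot x (A i *m u i).
set S3 := \sum_i cu i; set S6 := \sum_i ca i.
rewrite big_split/= sumrN -!mulr_sumr big_split/= sumrN -/S2 -/S3.
set S4 := \sum_i phi i ((A i)^T *m w).
set S5 := \sum_i phi i ((A i)^T *m w').
set N := n%:R^-1; set G := g x; set G' := g w'; set q := dot x ab => Gw SN.
have : theta * (N * S1) = theta * (lam * q) by rewrite SN.
move: Gw; lra.
Qed.

End one_step.

(** * Adapted processes of random sets *)

Section random_sets.
Context {R : realType} (dO : measure_display) (Omega : measurableType dO).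
Context (Pr : probability Omega R) (n : nat).

Definition set_law (X : Omega -> {set 'I_n}) (B : {set 'I_n}) : R :=
  fine (Pr (X @^-1` [set B])).

Lemma set_lawE X B : random_set X ->
  Pr (X @^-1` [set B]) = (set_law X B)%:E.
Proof. by move=> mX; rewrite fineK// fin_num_measure. Qed.

Lemma set_law_ge0 X B : 0 <= set_law X B.
Proof. exact: fine_ge0. Qed.

Lemma probability_random_set X (P : pred {set 'I_n}) : random_set X ->
  Pr [set omega | P (X omega)] = (\sum_(B | P B) set_law X B)%:E.
Proof.
move=> mX.
have -> : [set omega | P (X omega)] =
    \bigcup_(B in [set` enum P]) X @^-1` [set B].
  apply/seteqP; split=> [omega /= PX|omega [B]/=].
    by exists (X omega) => //=; rewrite mem_enum.
  by rewrite mem_enum => PB ->.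
rewrite measure_fin_bigcup//; last exact: trivIset_preimage1.
rewrite -fsbig_seq ?enum_uniq// big_enum -sumEFin.
by apply: eq_bigr => B _; exact: set_lawE.
Qed.

Lemma set_law_sum1 X : random_set X -> \sum_B set_law X B = 1.
Proof.
move=> mX; apply: EFin_inj; rewrite -(probability_random_set predT)//.
by rewrite -(@probability_setT _ _ _ Pr); congr (Pr _); apply/seteqP.
Qed.

End random_sets.

(** * Histories of draws and adapted processes *)

Section history.
Context {R : realType} (dO : measure_display) (Omega : measurableType dO).
Context (Pr : probability Omega R) (n : nat).
Context (X : nat -> Omega -> {set 'I_n}) (q : {set 'I_n} -> R).
Hypotheses (X_rand : forall t, random_set (X t))
  (X_law : forall t B, Pr (X t @^-1` [set B]) = (q B)%:E)
  (X_indep : independent_sets Pr X).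

(** An intersection over a duplicate-free list of times, the form to which [independent_sets]
    applies directly. *)
Definition history (l : seq {set 'I_n}) : set Omega :=
  \bigcap_(t in [set` iota 0 (size l)]) (X t @^-1` [set nth finset.set0 l t]).

Lemma historyP l omega : history l omega <->
  forall t, (t < size l)%N -> X t omega = nth finset.set0 l t.
Proof.
by split=> H t /=; have := H t; rewrite /= mem_iota.
Qed.

Lemma history_rcons l B omega : history (rcons l B) omega <->
  history l omega /\ X (size l) omega = B.
Proof.
rewrite !historyP size_rcons; split=> [H|[H XB] t].
  split=> [t tl|]; last by rewrite H// nth_rcons ltnn eqxx.
  by rewrite H ?(ltn_trans tl)// nth_rcons tl.
rewrite ltnS leq_eqVlt nth_rcons => /predU1P[->|tl].
  by rewrite ltnn eqxx.
by rewrite tl H.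
Qed.

Lemma measurable_history l : measurable (history l).
Proof.
by apply: fin_bigcap_measurable => // t _; exact: X_rand.
Qed.

Lemma history_bigcup l : history l = \bigcup_B history (rcons l B).
Proof.
apply/seteqP; split=> [omega H|omega [B _ /history_rcons[]//]].
by exists (X (size l) omega) => //; apply/history_rcons.
Qed.

Lemma probability_history l : Pr (history l) = (\prod_(B <- l) q B)%:E.
Proof.
rewrite /history (X_indep (fun t => [set nth finset.set0 l t])) ?iota_uniq//.
rewrite (big_nth finset.set0) /index_iota subn0.
elim: (iota 0 (size l)) => [|t s ih]; first by rewrite !big_nil.
by rewrite !big_cons ih X_law EFinM.
Qed.

Variable N : nat.

Definition adapted (T : Type) (f : Omega -> T) (k : nat) :=
  forall omega omega', (forall t, (t < k)%N -> X t omega = X t omega') ->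
    f omega = f omega'.

Lemma adapted_history T (f : Omega -> T) l omega omega' :
  adapted f (size l) -> history l omega -> history l omega' -> f omega = f omega'.
Proof.
move=> fa /historyP H /historyP H'; apply: fa => t tl.
by rewrite H// H'.
Qed.

(** [f] is constant on each history of length [N], and there are finitely many of these. The
    induction refines a history by one draw at a time. *)
Lemma adapted_measurable d' (T : measurableType d') (f : Omega -> T) D :
  adapted f N -> measurable D -> measurable_fun D f.
Proof.
move=> fa mD; suff fX l k Y : (size l + k = N)%N ->
    measurable (history l `&` f @^-1` Y).
  move=> _ Y mY; apply: measurableI => //.
  have := fX [::] N Y erefl; rewrite (_ : history [::] = setT) ?setTI//.
  by apply/seteqP; split=> // omega _; apply/historyP.
elim: k l => [|k ih] l lN; last first.
  rewrite history_bigcup setI_bigcupl; apply: fin_bigcup_measurable.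
    exact: finite_finset.
  by move=> B _; apply: ih; rewrite size_rcons -addSnnS in lN *.
have [[omega [lomega Yomega]]|none] :=
  pselect (exists omega, history l omega /\ Y (f omega)).
  rewrite (_ : _ `&` _ = history l); first exact: measurable_history.
  apply/seteqP; split=> [omega' []//|omega' lomega']; split=> //=.
  rewrite -(adapted_history _ lomega lomega')//; move: fa.
  by rewrite -lN addn0.
rewrite (_ : _ `&` _ = set0)//; apply/seteqP; split=> // omega [lo Yo].
by apply: none; exists omega.
Qed.

(* [next B] is an outcome extending the past of [omega] by the draw [B]; for an
   adapted process this replaces the conditional expectation given the past. *)
Lemma integral_history_contraction (G : nat -> Omega -> \bar R) (r : R) :
  (forall k, adapted (G k) k) -> (forall k omega, (0 <= G k omega)%E) ->
  (forall k omega (next : {set 'I_n} -> Omega), G k omega \is a fin_num ->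
    (forall B, q B != 0 ->
      X k (next B) = B /\ forall t, (t < k)%N -> X t (next B) = X t omega) ->
    (forall B, q B != 0 -> G k.+1 (next B) \is a fin_num) /\
    \sum_B q B * fine (G k.+1 (next B)) <= r * fine (G k omega)) ->
  0 <= r ->
  forall k l omega, (size l + k = N)%N -> history l omega ->
    G (size l) omega \is a fin_num ->
    (\int[Pr]_(x in history l) G N x <=
      (\prod_(B <- l) q B * (r ^+ k * fine (G (size l) omega)))%:E)%E.
Proof.
move=> Ga G0 Gstep r0; elim=> [|k ih] l omega lN lo Gfin.
  rewrite addn0 in lN; rewrite -lN.
  rewrite (eq_integral (cst (G (size l) omega))); last first.
    by move=> x /set_mem lx; exact: adapted_history lx lo.
  rewrite integral_cst; last exact: measurable_history.
  rewrite [X in (_ * X)%E](probability_history l) expr0 mul1r mulrC EFinM.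
  by rewrite fineK.
have mG (D : set Omega) : measurable D -> measurable_fun D (G N).
  by move=> mD; apply: adapted_measurable => //; exact: Ga.
(* A null history contributes nothing to the integral. *)
have [l0|l0] := eqVneq (\prod_(B <- l) q B) 0.
  rewrite l0 mul0r null_set_integral//.
  - exact: measurable_history.
  - by apply: mG; exact: measurable_history.
  - by apply: etrans (probability_history l) _; rewrite l0.
(* A draw of positive probability extends the non-null history [l] to a non-null, hence inhabited,
   event; for the other draws [next] is an arbitrary default. *)
have /choice[next nextP] : forall B, exists omega',
    q B != 0 -> history (rcons l B) omega'.
  move=> B; have [qB|qB] := eqVneq (q B) 0; first by exists omega.
  have : Pr (history (rcons l B)) != 0.
    by rewrite probability_history -cats1 big_cat big_seq1/= eqe mulf_neq0.
  have [->|/set0P[omega' H] _] := eqVneq (history (rcons l B)) set0.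
    by rewrite measure0 eqxx.
  by exists omega'.
have [|nextfin step] := Gstep (size l) omega next Gfin.
  move=> B /nextP/history_rcons[lB ->]; split=> // t tl.
  by move/historyP: lB => ->//; move/historyP: lo => ->.
rewrite history_bigcup.
rewrite (_ : \bigcup_B _ =
    \big[setU/set0]_(B <- index_enum {set 'I_n}) history (rcons l B)); last first.
  rewrite -bigcup_seq; congr (bigcup _ _); apply/seteqP; split=> // B _.
  by rewrite /= mem_index_enum.
rewrite ge0_integral_bigsetU//=; first last.
- by apply: mG; apply: bigsetU_measurable => B _; exact: measurable_history.
- move=> B C _ _ [x [/history_rcons[_ <-] /history_rcons[_ <-]]] //.
- exact: index_enum_uniq.
- by move=> B; exact: measurable_history.
apply: (@le_trans _ _ (\sum_B (\prod_(B <- l) q B * (r ^+ k *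
    (q B * fine (G (size l).+1 (next B)))))%:E)%E).
  apply: lee_sum => B _; have [qB|qB] := eqVneq (q B) 0.
    rewrite qB mul0r !mulr0 null_set_integral//.
    - exact: measurable_history.
    - by apply: mG; exact: measurable_history.
    - apply: etrans (probability_history _) _.
      by rewrite -cats1 big_cat big_seq1/= qB mulr0.
  have := ih (rcons l B) (next B); rewrite size_rcons addSnnS.
  move=> /(_ lN (nextP _ qB) (nextfin _ qB)) /le_trans; apply.
  rewrite -cats1 big_cat big_seq1/= lee_fin le_eqVlt; apply/orP; left.
  by apply/eqP; ring.
rewrite sumEFin lee_fin -!mulr_sumr exprSr -[in leRHS]mulrA.
apply: ler_wpM2l; last by rewrite ler_wpM2l ?exprn_ge0.
by rewrite -lee_fin -probability_history.
Qed.

End history.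

(** * Trajectories under serial sampling *)

Section serial_sampling.
Context {R : realType} (n : nat) (q : {set 'I_n} -> R).
Hypotheses (q_ge0 : forall B, 0 <= q B) (q_sum : \sum_B q B = 1).
Hypothesis q_serial : \sum_i q [set i]%SET = 1.

(** The singletons already carry the total mass, which leaves none for the other sets. *)
Lemma serial_law_eq0 B : (forall i, B != [set i]%SET) -> q B = 0.
Proof.
move=> BS; have := q_sum.
rewrite (bigID (mem [set [set i]%SET | i : 'I_n]))/= big_imset/=; last first.
  by move=> i j _ _; exact: set1_inj.
rewrite (eq_bigl xpredT) ?q_serial; last by move=> i; rewrite inE.
set r := (X in 1 + X) => r1; have {}r1 : r = 0 by lra.
apply: (psumr_eq0P _ r1) => //.
by apply/imsetP => -[i _ BE]; have := BS i; rewrite BE eqxx.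
Qed.

Lemma serial_sum (F : {set 'I_n} -> R) :
  \sum_B q B * F B = \sum_i q [set i]%SET * F [set i]%SET.
Proof.
rewrite (bigID (mem [set [set i]%SET | i : 'I_n]))/= big_imset/=; last first.
  by move=> i j _ _; exact: set1_inj.
rewrite [X in _ + X]big1 ?addr0; last first.
  move=> B /imsetP BS; rewrite serial_law_eq0 ?mul0r// => i.
  by apply/eqP => BE; apply: BS; exists i.
by apply: eq_bigl => i; rewrite inE.
Qed.

Lemma serial_inclusion i : \sum_(B : {set 'I_n} | i \in B) q B = q [set i]%SET.
Proof.
rewrite (bigD1 [set i]%SET) ?inE//= big1 ?addr0// => B /andP[iB Bi].
apply: serial_law_eq0 => j; apply: contra_neq Bi => BE.
by move: iB; rewrite BE inE => /eqP ->.
Qed.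

End serial_sampling.

(** * Trajectories as functions of the draws *)

Section trajectories.
Context {R : realType} (n d m : nat) (opt : quartz_option).
Context (phi : 'I_n -> 'cV[R]_m -> R) (g : 'cV[R]_d -> R) (lam gam : R).
Context (A : 'I_n -> 'M[R]_(d, m)) (p v : 'I_n -> R).
Context (w0 : 'cV[R]_d) (alpha0 : 'I_n -> 'cV[R]_m).
Hypotheses (n_gt0 : (0 < n)%N) (lam_gt0 : 0 < lam).
Hypothesis phi_convex : forall i, convex_on_space (phi i).
Hypothesis v_gt0 : forall i, 0 < v i.

(** Under Option I the quadratic term, with [v i] positive, makes the objective strictly concave:
    the midpoint of two distinct maximizers would do better. *)
Lemma quartz_update_unique theta i w ab a delta delta' :
  quartz_update opt phi g lam theta A p v i w ab a delta ->
  quartz_update opt phi g lam theta A p v i w ab a delta' -> delta = delta'.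
Proof.
case: opt => /= [|-> ->//] max1 max2.
set x := grad_conjugate g ab in max1 max2.
have [s phis] := convex_subgradient 0 (@phi_convex i).
have fin D : (forall E, ((- conjugate (phi i) (- (a + E))
      - (dot x (A i *m E))%:E - (v i * enorm E ^+ 2 / (2 * lam * n%:R))%:E)
    <= (- conjugate (phi i) (- (a + D))
      - (dot x (A i *m D))%:E - (v i * enorm D ^+ 2 / (2 * lam * n%:R))%:E))%E) ->
    exists c, conjugate (phi i) (- (a + D)) = c%:E.
  (* This competitor moves the conjugate's argument to the subgradient [s], where the conjugate is
     finite. *)
  move=> /(_ (- s - a)); rewrite subrKC opprK (conjugate_subgradient phis).
  have := conjugate_neqNy (phi i) (- (a + D)).
  by case: (conjugate _ (- (a + D))) => // c _ _; exists c.
have [c cE] := fin _ max1; have [e eE] := fin _ max2.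
pose z := 2^-1 *: (delta + delta').
have zE : - (a + z) = 2^-1 *: (- (a + delta) + - (a + delta')).
  by apply/matrixP => j l; rewrite !mxE; field.
have := conjugate_midpoint cE eE; rewrite -zE => fz.
have fzf := conjugate_fin_num fz.
have := max1 z; have := max2 z; move: fz.
rewrite -(fineK fzf) cE eE -!EFinN -!EFinD !lee_fin !enorm_sqr.
set f := fine _.
have -> : dot x (A i *m z) = 2^-1 * (dot x (A i *m delta) + dot x (A i *m delta')).
  by rewrite /z -scalemxAr mulmxDr dotZr dotDr.
have -> : dot z z = 2^-1 * (dot delta delta + dot delta' delta')
    - 4^-1 * dot (delta - delta') (delta - delta').
  by rewrite /z !dotE (dotC delta' delta); field.
set X := dot x (A i *m delta); set Y := dot x (A i *m delta').
set D := dot (_ - _) _; set DD := dot delta delta; set DD' := dot delta' delta'.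
have q0 : 0 < v i / (2 * lam * n%:R) by rewrite divr_gt0 ?mulr_gt0 ?ltr0n.
set q := v i / _ in q0 * => H1 H2 H3.
have : q * D <= 0 by rewrite /q; lra.
rewrite pmulr_rle0// => D0; apply/eqP; rewrite -subr_eq0 -dot_eq0 -/D.
by rewrite eq_le D0 dot_ge0.
Qed.

Lemma quartz_path_abarE S w alpha abar Delta :
  quartz_path opt phi g lam gam A p v w0 alpha0 S w alpha abar Delta ->
  forall t, abar t = dual_average lam A (alpha t).
Proof.
move=> P; elim=> [|t ih].
  rewrite (quartz_abar0 P) /dual_average; congr (_ *: _).
  by apply: eq_bigr => i _; rewrite (quartz_alpha0 P).
rewrite (quartz_abar P) ih /dual_average -scalerDr; congr (_ *: _).
rewrite [X in _ + X]big_mkcond -big_split; apply: eq_bigr => i _ /=.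
have [iS|iS] := boolP (i \in S t.+1).
  by rewrite (quartz_alpha_in P iS) mulmxDr.
by rewrite (quartz_alpha_notin P iS) addr0.
Qed.

(** Gives adaptedness: the [k]-th iterates depend only on the draws numbered [1] to [k]. *)
Lemma quartz_path_unique S w alpha abar Delta S' w' alpha' abar' Delta' k :
  quartz_path opt phi g lam gam A p v w0 alpha0 S w alpha abar Delta ->
  quartz_path opt phi g lam gam A p v w0 alpha0 S' w' alpha' abar' Delta' ->
  (forall t, (t < k)%N -> S t.+1 = S' t.+1) ->
  w k = w' k /\ alpha k = alpha' k.
Proof.
move=> P P'; elim: k => [_|k ih SS].
  rewrite (quartz_w0 P) (quartz_w0 P'); split=> //.
  by apply/funext => i; rewrite (quartz_alpha0 P) (quartz_alpha0 P').
have [|wE aE] := ih; first by move=> t tk; rewrite SS// ltnW.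
have abE : abar k = abar' k.
  by rewrite (quartz_path_abarE P) (quartz_path_abarE P') aE.
have wE' : w k.+1 = w' k.+1 by rewrite (quartz_w P) (quartz_w P') wE abE.
split=> //; apply/funext => i; have [iS|iS] := boolP (i \in S k.+1).
  have iS' : i \in S' k.+1 by rewrite -SS.
  rewrite (quartz_alpha_in P iS) (quartz_alpha_in P' iS') -aE; congr (_ + _).
  have := quartz_Delta P' iS'; rewrite -wE' -abE -aE.
  exact: quartz_update_unique (quartz_Delta P iS).
have iS' : i \notin S' k.+1 by rewrite -SS.
by rewrite (quartz_alpha_notin P iS) (quartz_alpha_notin P' iS') aE.
Qed.

End trajectories.

(** * The iteration complexity bound *)

Lemma expr_onem_le_of_ln (R : realType) (theta D eps : R) (T : nat) :
  theta <= 1 -> 0 < eps -> 0 < D -> ln (D / eps) <= theta * T%:R ->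
  (1 - theta) ^+ T * D <= eps.
Proof.
move=> th1 e0 D0 lnT; rewrite -ler_pdivlMr//.
have -> : eps / D = expR (- ln (D / eps)).
  by rewrite expRN lnK ?posrE ?divr_gt0// invf_div.
apply: (@le_trans _ _ (expR (- theta) ^+ T)).
  by apply: lerXn2r; rewrite ?nnegrE ?subr_ge0 ?expR_ge0 ?expR_ge1Dx.
by rewrite -expRM_natl ler_expR mulrN lerN2 [leRHS]mulrC.
Qed.

Theorem corollary11 (R : realType) (n d m : nat)
    (phi : 'I_n -> 'cV[R]_m -> R) (g : 'cV[R]_d -> R) (gam lam : R)
    (A : 'I_n -> 'M[R]_(d, m)) (v : 'I_n -> R)
    (dO : measure_display) (Omega : measurableType dO) (Pr : probability Omega R)
    (Shat : Omega -> {set 'I_n}) (S : nat -> Omega -> {set 'I_n})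
    (opt : quartz_option)
    (w0 : 'cV[R]_d) (alpha0 : 'I_n -> 'cV[R]_m)
    (w : nat -> Omega -> 'cV[R]_d) (alpha : nat -> Omega -> 'I_n -> 'cV[R]_m)
    (abar : nat -> Omega -> 'cV[R]_d) (Delta : nat -> Omega -> 'I_n -> 'cV[R]_m)
    (eps : R) (T : nat)
    (n_gt0 : (0 < n)%N) (gam_gt0 : 0 < gam) (lam_gt0 : 0 < lam)
    (phi_convex : forall i, convex_on_space (phi i))
    (phi_diff : forall i x, differentiable (phi i) x)
    (phi_smooth : forall i, lipschitz_gradient gam^-1 (phi i))
    (g_sc : strongly_convex1 g)
    (A_neq0 : forall i, A i != 0)
    (v_eq : forall i, v i = lambda_max ((A i)^T *m A i))
    (draws : quartz_draws Pr Shat S)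
    (Shat_serial : forall i,
      Pr (Shat @^-1` [set [set i]%SET]) =
      ((lambda_max ((A i)^T *m A i) + lam * gam * n%:R)
       / \sum_(k < n) (lambda_max ((A k)^T *m A k) + lam * gam * n%:R))%:E)
    (run : forall omega,
      quartz_path opt phi g lam gam A (inclusion_probability Pr Shat) v
        w0 alpha0 (S ^~ omega) (w ^~ omega) (alpha ^~ omega)
        (abar ^~ omega) (Delta ^~ omega))
    (eps_gt0 : 0 < eps)
    (eps_le : (eps%:E <= (primal phi g lam A w0)%:E - dual phi g lam A alpha0)%E)
    (T_ge :
      ((n%:R + n%:R^-1 * (\sum_(i < n) lambda_max ((A i)^T *m A i))
               / (lam * gam))%:E
       * lne (((primal phi g lam A w0)%:E - dual phi g lam A alpha0) / eps%:E)
       <= T%:R%:E)%E) :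
  (\int[Pr]_omega ((primal phi g lam A (w T omega))%:E
                   - dual phi g lam A (alpha T omega)) <= eps%:E)%E.
Proof.
set vL := fun i => lambda_max ((A i)^T *m A i) in T_ge.
have v_gt0 i : 0 < v i by rewrite v_eq lambda_max_gt0.
have A_v i x : dot (A i *m x) (A i *m x) <= v i * dot x x.
  by rewrite v_eq rayleigh_lambda_max.
have [Shat_rand S_rand S_law S_indep] := draws.
have nR : 0 < n%:R :> R by rewrite ltr0n.
have lgn : 0 < lam * gam * n%:R by rewrite !mulr_gt0.
have vl i : 0 < v i + lam * gam * n%:R by rewrite addr_gt0.
pose sigma := \sum_k (v k + lam * gam * n%:R).
have sigma_gt0 : 0 < sigma.
  rewrite /sigma (bigD1 (Ordinal n_gt0))//= ltr_pwDl// sumr_ge0// => i _.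
  exact: ltW.
pose q := set_law Pr Shat.
have q1 i : q [set i]%SET = (v i + lam * gam * n%:R) / sigma.
  rewrite /q /set_law Shat_serial/= -v_eq; congr (_ / _).
  by apply: eq_bigr => k _; rewrite v_eq.
have q_ge0 B : 0 <= q B by exact: set_law_ge0.
have q_sum : \sum_B q B = 1 by exact: set_law_sum1.
have q_serial : \sum_i q [set i]%SET = 1.
  rewrite (eq_bigr _ (fun i _ => q1 i)) -mulr_suml -/sigma divff//.
  by rewrite gt_eqF.
set p := inclusion_probability Pr Shat in run.
have pE i : p i = q [set i]%SET.
  rewrite /p /inclusion_probability.
  rewrite (probability_random_set Pr (fun B => i \in B) Shat_rand)/=.
  exact: serial_inclusion.
have p_gt0 i : 0 < p i by rewrite pE q1 divr_gt0.
have p_sum : \sum_i p i = 1 by under eq_bigr do rewrite pE.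
set theta := quartz_theta lam gam p v.
(* The factor [v i + lam * gam * n%:R] of [p i] cancels the denominator, so all the ratios in the
   minimum coincide. *)
have thetaE : theta = lam * gam * n%:R / sigma.
  rewrite /theta /quartz_theta [X in inf X](_ : _ = [set lam * gam * n%:R / sigma]).
    exact: inf1.
  apply/seteqP; split=> [_ [i _ <-]|_ ->] /=.
    by rewrite pE q1; field; rewrite !gt_eqF.
  exists (Ordinal n_gt0) => //.
  by rewrite pE q1; field; rewrite !gt_eqF.
have theta_p i : theta * (v i + lam * gam * n%:R) = p i * (lam * gam * n%:R).
  by rewrite thetaE pE q1; field; rewrite gt_eqF.
have th0 := theta_gt0 n_gt0 lam_gt0 gam_gt0 v_gt0 p_gt0 theta_p.
have th1 := theta_le1 n_gt0 lam_gt0 gam_gt0 v_gt0 p_gt0 p_sum theta_p.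
pose G k omega := ((primal phi g lam A (w k omega))%:E
  - dual phi g lam A (alpha k omega))%E.
have finG k omega : G k omega \is a fin_num -> dual_finite phi (alpha k omega).
  move=> Gfin; apply: contrapT => nfin; move: Gfin.
  by rewrite /G duality_gap_pinfty.
have GE k omega : dual_finite phi (alpha k omega) ->
    G k omega = (duality_gap phi g lam A (w k omega) (alpha k omega))%:E.
  by move=> fin; rewrite /G duality_gapE.
have G_ge0 k omega : (0 <= G k omega)%E.
  have [fin|nfin] := pselect (dual_finite phi (alpha k omega)).
    by rewrite GE// lee_fin duality_gap_ge0.
  by rewrite /G duality_gap_pinfty.
(* The shift numbers the first actual draw [0], so that the first [k] draws are those with
   [t < k]. *)
pose X t := S t.+1.
have unique k omega omega' : (forall t, (t < k)%N -> X t omega = X t omega') ->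
    w k omega = w k omega' /\ alpha k omega = alpha k omega'.
  exact: (quartz_path_unique n_gt0 lam_gt0 phi_convex v_gt0
    (run omega) (run omega')).
have G_adapted k : adapted X (G k) k.
  by move=> omega omega' /unique[wE aE]; rewrite /G wE aE.
have X_law t B : Pr (X t @^-1` [set B]) = (q B)%:E.
  by rewrite /X S_law; exact: set_lawE.
have Gstep k omega (next : {set 'I_n} -> Omega) : G k omega \is a fin_num ->
    (forall B, q B != 0 -> X k (next B) = B /\
      forall t, (t < k)%N -> X t (next B) = X t omega) ->
    (forall B, q B != 0 -> G k.+1 (next B) \is a fin_num) /\
    \sum_B q B * fine (G k.+1 (next B)) <= (1 - theta) * fine (G k omega).
  move=> /finG fin nextP.
  (* An outcome with the past of [omega] whose next draw is the singleton of [i]. *)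
  pose om i := next [set i]%SET.
  have omP i : [/\ S k.+1 (om i) = [set i]%SET, w k (om i) = w k omega
      & alpha k (om i) = alpha k omega].
    have [|XB /unique[]//] := nextP [set i]%SET.
    by rewrite -pE gt_eqF.
  pose w' := (1 - theta) *: w k omega
    + theta *: grad_conjugate g (dual_average lam A (alpha k omega)).
  have wE i : w k.+1 (om i) = w'.
    have [_ wk ak] := omP i; rewrite (quartz_w (run (om i))) -/theta.
    by rewrite (quartz_path_abarE (run (om i))) wk ak.
  pose Dl i := Delta k.+1 (om i) i.
  pose beta i := alpha k.+1 (om i).
  have upd i : quartz_update opt phi g lam theta A p v i w'
      (dual_average lam A (alpha k omega)) (alpha k omega i) (Dl i).
    have [Sk wk ak] := omP i.
    have := quartz_Delta (run (om i)) (t := k) (i := i).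
    rewrite Sk inE eqxx => /(_ isT).
    by rewrite (quartz_path_abarE (run (om i))) -/theta wE ak.
  have beta_in i : beta i i = alpha k omega i + Dl i.
    have [Sk wk ak] := omP i.
    by rewrite /beta (quartz_alpha_in (run (om i))) ?Sk ?inE// ak.
  have beta_notin i j : j != i -> beta i j = alpha k omega j.
    move=> ji; have [Sk wk ak] := omP i.
    by rewrite /beta (quartz_alpha_notin (run (om i))) ?Sk ?inE// ak.
  have beta_fin := quartz_step_finite n_gt0 lam_gt0 gam_gt0 phi_convex phi_diff
    phi_smooth v_gt0 p_gt0 theta_p fin upd beta_in beta_notin.
  have GB i : G k.+1 (om i) = (duality_gap phi g lam A w' (beta i))%:E.
    by rewrite GE ?wE//; exact: beta_fin.
  split=> [B qB|].
    have [[i ->]|none] := pselect (exists i, B = [set i]%SET).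
      by rewrite -/(om i) GB.
    case/eqP: qB; apply: (serial_law_eq0 q_ge0 q_sum q_serial) => i.
    by apply/eqP => BE; apply: none; exists i.
  rewrite (serial_sum q_ge0 q_sum q_serial (fun B => fine (G k.+1 (next B)))).
  rewrite GE//= (eq_bigr (fun i => p i * duality_gap phi g lam A w' (beta i))).
    exact: (quartz_step_contraction n_gt0 lam_gt0 gam_gt0 phi_convex phi_diff
      phi_smooth g_sc v_gt0 A_v p_gt0 p_sum theta_p fin upd beta_in beta_notin).
  by move=> i _; rewrite -/(om i) GB pE.
have [omega0 _] : exists omega : Omega, setT omega.
  apply/set0P; apply/eqP => T0.
  have := probability_setT Pr; rewrite T0 measure0 => /esym/eqP.
  by rewrite onee_eq0.
have G0E : G 0%N omega0 =
    ((primal phi g lam A w0)%:E - dual phi g lam A alpha0)%E.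
  rewrite /G (quartz_w0 (run omega0)); congr (_ - dual _ _ _ _ _)%E.
  by apply/funext => i; rewrite (quartz_alpha0 (run omega0)).
rewrite -G0E in eps_le T_ge.
have theta_inv : n%:R + n%:R^-1 * (\sum_i vL i) / (lam * gam) = theta^-1.
  have sigmaE : sigma = \sum_i vL i + lam * gam * n%:R * n%:R.
    rewrite /sigma big_split/= sumr_const card_ord -[_ *+ n]mulr_natr.
    by congr (_ + _); apply: eq_bigr => i _; exact: v_eq.
  rewrite thetaE invf_div sigmaE; field.
  by rewrite !gt_eqF.
(* An infinite initial gap would make the left side of [T_ge] infinite, while [T] is finite. *)
have G0fin : G 0%N omega0 \is a fin_num.
  rewrite fin_numE gt_eqF ?(lt_le_trans _ (G_ge0 _ _)) ?ltNy0//=.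
  apply/eqP => Ginf; move: T_ge; rewrite Ginf theta_inv inver gt_eqF//.
  by rewrite gt0_mulye ?lte_fin ?invr_gt0//= gt0_muley ?lte_fin ?invr_gt0.
have := integral_history_contraction (N := T) S_rand X_law S_indep G_adapted
  G_ge0 Gstep _ (k := T) (l := [::]) (omega := omega0).
rewrite subr_ge0 big_nil mul1r => /(_ th1 erefl) H.
(* The empty history is the whole space, so the contraction bounds the full expectation. *)
have hT : history X [::] = setT by apply/seteqP; split=> // x _; apply/historyP.
rewrite hT in H; apply: (le_trans (H _ G0fin)) => //.
rewrite lee_fin; apply: expr_onem_le_of_ln => //.
  by rewrite -lte_fin fineK// (lt_le_trans _ eps_le)// lte_fin.
move: T_ge; rewrite theta_inv -(fineK G0fin) inver gt_eqF// -EFinM lne_EFin.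
  by rewrite -EFinM lee_fin ler_pdivrMl.
by rewrite divr_gt0// -lte_fin fineK// (lt_le_trans _ eps_le)// lte_fin.
Qed.
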